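(* Let $R$ be a commutative ring, $\sigma\in\mathrm{Aut}(R)$ with $\sigma^p=\mathrm{Id}_R$, $\omega=\{\mathfrak m_0,\dots,\sigma^{p-1}(\mathfrak m_0)\}$ a $\sigma$-orbit in $\mathrm{MaxSpec}(R)$ with $p$ elements, $\Bbbk=R/\mathfrak m_0$, and $t,t'\in R$ regular elements. Let $w=w_{i+1}\cdots w_{i+\ell}\in\mathbf D^t_\omega$ be such that $V^t(\omega,i,w)$ is defined, suppose $B^{t'}_\omega=\emptyset$, and let $F\in\mathrm{Aut}_\Bbbk(\Bbbk^d)$. Then, as $A(tt')$-modules, $$V^t(\omega,i,w)\otimes_RV^{t'}(\omega,1^p,F)\simeq V^{tt'}(\omega,i,w)^{\oplus d}.$$
   Context: $A(t)$ is the ring generated over $R$ by $X,Y$ with $Xr=\sigma(r)X$, $Yr=\sigma^{-1}(r)Y$ ($r\in R$), $YX=t$, $XY=\sigma(t)$. A weight module is an $A(t)$-module $M=\bigoplus_{\mathfrak m\in\mathrm{MaxSpec}(R)}M_{\mathfrak m}$, $M_{\mathfrak m}=\{v\mid\mathfrak mv=0\}$. For a weight $A(t)$-module $M$ and a weight $A(t')$-module $M'$, $M\otimes_RM'$ is an $A(tt')$-module via $X(v\otimes v')=Xv\otimes Xv'$, $Y(v\otimes v')=Yv\otimes Yv'$. $B^t_\omega=\{\mathfrak m\in\omega\mid t\in\mathfrak m\}$. $\mathbf D^t_\omega$ is the set of indexed words $w=w_jw_{j+1}\cdots w_{j+m}$ with letters $w_k\in\{1,x,y,0\}$ such that $w_k=1$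 iff $\sigma^k(\mathfrak m_0)\notin B^t_\omega$. For $0\le i\le p-1$ with $\sigma^i(\mathfrak m_0)\in B^t_\omega$ and $w=w_{i+1}\cdots w_{i+\ell}\in\mathbf D^t_\omega$ ($\ell\ge0$) with $\sigma^{i+\ell+1}(\mathfrak m_0)\in B^t_\omega$, $V^t(\omega,i,w)=\bigoplus_{i+1\le k\le i+\ell+1}(R/\sigma^k(\mathfrak m_0))e_k$ with $Xe_k=\sigma(t)e_{k+1}$ if $k\ne i+\ell+1,w_k=1$; $e_{k+1}$ if $k\ne i+\ell+1,w_k=x$; $0$ if $k=i+\ell+1$ or $w_k\in\{y,0\}$; $Ye_k=e_{k-1}$ if $k\ne i+1,w_{k-1}\in\{1,y\}$; $0$ if $k=i+1$ or $w_{k-1}\in\{x,0\}$. For $B^{t'}_\omega=\emptyset$, $V^{t'}(\omega,1^p,F)=\bigoplus_{1\le k\le p,\,1\le s\le d}(R/\sigma^k(\mathfrak m_0))e_{k,s}$ with $Xe_{k,s}=\sigma(t')e_{k+1,s}$ for $k\ne p$, $Xe_{p,s}=\sigma(t')\sigma(F)e_{1,s}$, $Ye_{k,s}=e_{k-1,s}$ for $k\ne1$, $Ye_{1,s}=F^{-1}e_{p,s}$, where $\Bbbk^d$ is identified with $\bigoplus_s\Bbbk e_{p,s}$ and $\sigma(F)$ is the matrix over $R/\sigma(\mathfrak m_0)$ obtained from $F$ via the isomorphism $R/\mathfrak m_0\to R/\sigma(\mathfrak m_0)$ induced by $\sigma$. In all cases $X(rv)=\sigma(r)Xv$, $Y(rv)=\sigma^{-1}(r)Yv$.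 *)

(* Defs.v *)
From HB Require Import structures.
From mathcomp Require Import all_boot all_algebra generic_quotient ring_quotient.
From mathcomp Require Import boolp classical_sets functions cardinality.

Set Implicit Arguments.
Unset Strict Implicit.
Unset Printing Implicit Defensive.

Import GRing.Theory.
Local Open Scope ring_scope.
Local Open Scope quotient_scope.

Record raut (R : pzRingType) := RAut {
  raut_fun :> {rmorphism R -> R};
  raut_inv : R -> R;
  rautK : cancel raut_fun raut_inv;
  rautVK : cancel raut_inv raut_fun }.

Section RautInv.
Variables (R : pzRingType) (sigma : raut R).

Lemma raut_invD : {morph raut_inv sigma : x y / x + y}.
Proof.
move=> x y; apply: (can_inj (rautK sigma)).
by rewrite rmorphD !rautVK.
Qed.

Lemma raut_invM : {morph raut_inv sigma : x y / x * y}.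
Proof.
move=> x y; apply: (can_inj (rautK sigma)).
by rewrite rmorphM !rautVK.
Qed.

Lemma raut_inv1 : raut_inv sigma 1 = 1.
Proof. by apply: (can_inj (rautK sigma)); rewrite rmorph1 rautVK. Qed.

Lemma raut_invB x y :
  raut_inv sigma (x - y) = raut_inv sigma x - raut_inv sigma y.
Proof. by apply: (can_inj (rautK sigma)); rewrite rmorphB !rautVK. Qed.

Lemma raut_inv0 : raut_inv sigma 0 = 0.
Proof. by apply: (can_inj (rautK sigma)); rewrite rmorph0 rautVK. Qed.

End RautInv.

(* Boolean predicates lose no generality: every subset of R is of this form
   by the excluded middle. [idealr_closed] includes properness. *)
Definition maximal_ideal (R : comNzRingType) (I : {pred R}) : Prop :=
  idealr_closed I /\
  forall J : {pred R}, idealr_closed J -> {subset I <= J} -> J =i I.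

Record maxSpec (R : comNzRingType) := MaxSpec {
  mideal :> {pred R};
  midealP : maximal_ideal mideal }.

Lemma maxSpec_eq (R : comNzRingType) (m n : maxSpec R) :
  (m : {pred R}) =i (n : {pred R}) -> m = n.
Proof.
case: m n => [m Pm] [n Pn] /= mn.
have E : m = n by apply: funext => x; exact: (mn x).
by move: Pm Pn; rewrite E => Pm Pn; congr MaxSpec; exact: Prop_irrelevance.
Qed.

HB.instance Definition _ (R : comNzRingType) (m : maxSpec R) :=
  isIdealr.Build R (mideal m) (midealP m).1.

Section Residue.
Variables (R : comNzRingType) (m : maxSpec R).

Definition residue : Type := {ideal_quot (mideal m)}.

HB.instance Definition _ := GRing.ComNzRing.on residue.
HB.instance Definition _ := EqQuotient.on residue.

Lemma piresE (x y : R) :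
  (\pi_residue x = \pi_residue y) <-> (x - y \in mideal m).
Proof.
split=> [/eqP|] h; first by rewrite Quotient.idealrBE.
by apply/eqP; rewrite -Quotient.idealrBE.
Qed.

Lemma pires0 (x : R) : (\pi_residue x = 0) <-> (x \in mideal m).
Proof.
have -> : (0 : residue) = \pi_residue 0 by rewrite [RHS]raddf0.
by rewrite piresE subr0.
Qed.

Lemma piresD (x y : R) :
  \pi_residue (x + y) = \pi_residue x + \pi_residue y.
Proof. exact: (raddfD (\pi_{ideal_quot (mideal m)})). Qed.

Lemma piresM (x y : R) :
  \pi_residue (x * y) = \pi_residue x * \pi_residue y.
Proof. exact: (rmorphM (\pi_{ideal_quot (mideal m)})). Qed.

Lemma pires1 : \pi_residue 1 = 1.
Proof. exact: (rmorph1 (\pi_{ideal_quot (mideal m)})). Qed.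

Lemma residue_inv_ex (x : residue) : x != 0 -> exists y, y * x = 1.
Proof.
move=> x0; pose a : R := repr x.
have xE : x = \pi_residue a by rewrite reprK.
have am : a \notin mideal m.
  by apply/negP => /pires0 ax; move: x0; rewrite xE ax eqxx.
apply: contrapT => nex.
pose J : {pred R} := fun z => `[< exists b c, c \in mideal m /\ z = b * a + c >].
have [m0 m1 mD] := (midealP m).1.
have Jcl : idealr_closed J.
  split.
  - by apply/asboolP; exists 0, 0; rewrite mul0r addr0.
  - apply/negP => /asboolP[b [c [cm E]]]; apply: nex; exists (\pi_residue b).
    rewrite xE -piresM -pires1; apply/piresE.
    by rewrite E opprD addNKr -[- c]addr0 -mulN1r; apply: mD.
  - move=> r u v /asboolP[b [c [cm ->]]] /asboolP[b' [c' [c'm ->]]].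
    apply/asboolP; exists (r * b + b'), (r * c + c'); split; first exact: mD.
    by rewrite mulrDr mulrDl mulrA addrACA.
have sub : {subset mideal m <= J}.
  by move=> c cm; apply/asboolP; exists 0, c; rewrite mul0r add0r.
have := (midealP m).2 J Jcl sub a.
rewrite (negbTE am) => /negP; apply; apply/asboolP.
by exists 1, 0; rewrite mul1r addr0.
Qed.

Definition residue_inv (x : residue) : residue := xget 0 [set y | y * x = 1].

Lemma residue_mulVf (x : residue) : x != 0 -> residue_inv x * x = 1.
Proof.
move=> /residue_inv_ex [y yx].
by rewrite /residue_inv; case: xgetP => [z _ //|/(_ y)].
Qed.

Lemma residue_inv0 : residue_inv 0 = 0.
Proof.
rewrite /residue_inv; case: xgetP => // z _ /= /eqP.
by rewrite mulr0 eq_sym oner_eq0.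
Qed.

HB.instance Definition _ :=
  GRing.ComNzRing_isField.Build residue residue_mulVf residue_inv0.

Definition residue_scale (r : R) (x : residue) : residue := \pi_residue r * x.

Lemma residue_scaleA a b v :
  residue_scale a (residue_scale b v) = residue_scale (a * b) v.
Proof. by rewrite /residue_scale mulrA piresM. Qed.
Lemma residue_scale1 : left_id 1 residue_scale.
Proof. by move=> v; rewrite /residue_scale pires1 mul1r. Qed.
Lemma residue_scaleDr : right_distributive residue_scale +%R.
Proof. by move=> a u v; rewrite /residue_scale mulrDr. Qed.
Lemma residue_scaleDl v : {morph residue_scale^~ v : a b / a + b}.
Proof. by move=> a b; rewrite /residue_scale piresD mulrDl. Qed.

HB.instance Definition _ := GRing.Zmodule_isLmodule.Build R residue
  residue_scaleA residue_scale1 residue_scaleDr residue_scaleDl.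

End Residue.

Section MaxSpecAction.
Variables (R : comNzRingType) (sigma : raut R).

(* The image ideal sigma(m), described as the preimage of m under sigma^-1. *)
Definition image_pred (I : {pred R}) : {pred R} :=
  [pred x | raut_inv sigma x \in I].

Lemma image_maximal (m : maxSpec R) : maximal_ideal (image_pred m).
Proof.
have [[m0 m1 mD] mmax] := midealP m; split.
  split; rewrite ?inE ?raut_inv0 ?raut_inv1 //.
  move=> a u v; rewrite !inE raut_invD raut_invM => um vm; exact: mD.
move=> J [J0 J1 JD] sub x.
pose J' : {pred R} := [pred y | sigma y \in J].
have J'cl : idealr_closed J'.
  split; rewrite ?inE ?rmorph0 ?rmorph1 //.
  by move=> a u v; rewrite !inE rmorphD rmorphM => uJ vJ; exact: JD.
have sub' : {subset mideal m <= J'}.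
  by move=> y ym; rewrite inE; apply: sub; rewrite inE rautK.
by have := mmax J' J'cl sub' (raut_inv sigma x); rewrite !inE rautVK.
Qed.

Definition sigma_max (m : maxSpec R) : maxSpec R :=
  MaxSpec (image_maximal m).

Definition sigma_res (m : maxSpec R) (x : residue m) : residue (sigma_max m) :=
  \pi_(residue (sigma_max m)) (sigma (repr x)).

Definition sigmak (m0 : maxSpec R) (k : nat) : maxSpec R :=
  iter k sigma_max m0.

Definition orbit_set (m0 : maxSpec R) (p : nat) : set (maxSpec R) :=
  [set m | exists2 i, (i < p)%N & m = sigmak m0 i].

(* B^t_omega, for omega = orbit_set m0 p. *)
Definition break_set (m0 : maxSpec R) (p : nat) (t : R) : set (maxSpec R) :=
  [set m | orbit_set m0 p m /\ t \in mideal m].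

End MaxSpecAction.

(* The ring A(t) is presented literally: formal ring expressions in constants
   from R and two symbols X, Y, modulo the congruence generated by the ring
   axioms, the ring operations of R and the defining relations. *)
Inductive gexpr (R : Type) :=
  | GC of R | GX | GY
  | GAdd of gexpr R & gexpr R
  | GOpp of gexpr R
  | GMul of gexpr R & gexpr R.
Arguments GX {R}.
Arguments GY {R}.

HB.instance Definition _ (R : Type) := gen_eqMixin (gexpr R).
HB.instance Definition _ (R : Type) := gen_choiceMixin (gexpr R).

Section GWA.
Variables (R : comNzRingType) (sigma : raut R) (t : R).

Inductive gcong : gexpr R -> gexpr R -> Prop :=
  | gc_refl a : gcong a a
  | gc_sym a b : gcong a b -> gcong b a
  | gc_trans a b c : gcong a b -> gcong b c -> gcong a c
  | gc_add a a' b b' : gcong a a' -> gcong b b' ->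
      gcong (GAdd a b) (GAdd a' b')
  | gc_opp a a' : gcong a a' -> gcong (GOpp a) (GOpp a')
  | gc_mul a a' b b' : gcong a a' -> gcong b b' ->
      gcong (GMul a b) (GMul a' b')
  | gc_addA a b c : gcong (GAdd a (GAdd b c)) (GAdd (GAdd a b) c)
  | gc_addC a b : gcong (GAdd a b) (GAdd b a)
  | gc_add0 a : gcong (GAdd (GC 0) a) a
  | gc_addN a : gcong (GAdd (GOpp a) a) (GC 0)
  | gc_mulA a b c : gcong (GMul a (GMul b c)) (GMul (GMul a b) c)
  | gc_mul1l a : gcong (GMul (GC 1) a) a
  | gc_mul1r a : gcong (GMul a (GC 1)) a
  | gc_mulDl a b c : gcong (GMul (GAdd a b) c) (GAdd (GMul a c) (GMul b c))
  | gc_mulDr a b c : gcong (GMul a (GAdd b c)) (GAdd (GMul a b) (GMul a c))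
  | gc_CD r s : gcong (GC (r + s)) (GAdd (GC r) (GC s))
  | gc_CM r s : gcong (GC (r * s)) (GMul (GC r) (GC s))
  | gc_XC r : gcong (GMul GX (GC r)) (GMul (GC (sigma r)) GX)
  | gc_YC r : gcong (GMul GY (GC r)) (GMul (GC (raut_inv sigma r)) GY)
  | gc_YX : gcong (GMul GY GX) (GC t)
  | gc_XY : gcong (GMul GX GY) (GC (sigma t)).

Definition gcongb (a b : gexpr R) : bool := `[< gcong a b >].

Lemma gcongb_equiv : equiv_class_of gcongb.
Proof.
split=> [a|a b|b a c].
- by apply/asboolP; exact: gc_refl.
- by apply/asboolP/asboolP; exact: gc_sym.
- move=> /asboolP ab /asboolP bc; apply/asboolP; exact: gc_trans ab bc.
Qed.

Canonical gcongb_equivRel := EquivRelPack gcongb_equiv.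

Definition gwa : Type := {eq_quot gcongb}.

HB.instance Definition _ := Choice.on gwa.
HB.instance Definition _ := EqQuotient.on gwa.

Lemma gwaE (a b : gexpr R) : gcong a b <-> \pi_gwa a = \pi_gwa b.
Proof.
split=> [h|/eqP]; first by apply/eqP; rewrite eqmodE; apply/asboolP.
by rewrite eqmodE => /asboolP.
Qed.

Lemma repr_gcong (a : gexpr R) : gcong (repr (\pi_gwa a)) a.
Proof. by apply/gwaE; rewrite reprK. Qed.

Definition gwa_add (a b : gwa) : gwa := \pi_gwa (GAdd (repr a) (repr b)).
Definition gwa_opp (a : gwa) : gwa := \pi_gwa (GOpp (repr a)).
Definition gwa_mul (a b : gwa) : gwa := \pi_gwa (GMul (repr a) (repr b)).

Lemma pi_gadd a b : \pi_gwa (GAdd a b) = gwa_add (\pi_gwa a) (\pi_gwa b).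
Proof. by apply/gwaE; apply: gc_add; apply: gc_sym; exact: repr_gcong. Qed.
Lemma pi_gopp a : \pi_gwa (GOpp a) = gwa_opp (\pi_gwa a).
Proof. by apply/gwaE; apply: gc_opp; apply: gc_sym; exact: repr_gcong. Qed.
Lemma pi_gmul a b : \pi_gwa (GMul a b) = gwa_mul (\pi_gwa a) (\pi_gwa b).
Proof. by apply/gwaE; apply: gc_mul; apply: gc_sym; exact: repr_gcong. Qed.

Lemma gwa_addA : associative gwa_add.
Proof.
elim/quotW=> a; elim/quotW=> b; elim/quotW=> c.
rewrite -(pi_gadd b c) -(pi_gadd a b) -!pi_gadd.
by apply/gwaE; exact: gc_addA.
Qed.
Lemma gwa_addC : commutative gwa_add.
Proof.
by elim/quotW=> a; elim/quotW=> b; rewrite -!pi_gadd; apply/gwaE; exact: gc_addC.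
Qed.
Lemma gwa_add0 : left_id (\pi_gwa (GC 0)) gwa_add.
Proof. by elim/quotW=> a; rewrite -!pi_gadd; apply/gwaE; exact: gc_add0. Qed.
Lemma gwa_addN : left_inverse (\pi_gwa (GC 0)) gwa_opp gwa_add.
Proof.
elim/quotW=> a; rewrite -(pi_gopp a) -pi_gadd.
by apply/gwaE; exact: gc_addN.
Qed.

HB.instance Definition _ := GRing.isZmodule.Build gwa
  gwa_addA gwa_addC gwa_add0 gwa_addN.

Lemma gwa_mulA : associative gwa_mul.
Proof.
elim/quotW=> a; elim/quotW=> b; elim/quotW=> c.
rewrite -(pi_gmul b c) -(pi_gmul a b) -!pi_gmul.
by apply/gwaE; exact: gc_mulA.
Qed.
Lemma gwa_mul1l : left_id (\pi_gwa (GC 1)) gwa_mul.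
Proof. by elim/quotW=> a; rewrite -!pi_gmul; apply/gwaE; exact: gc_mul1l. Qed.
Lemma gwa_mul1r : right_id (\pi_gwa (GC 1)) gwa_mul.
Proof. by elim/quotW=> a; rewrite -!pi_gmul; apply/gwaE; exact: gc_mul1r. Qed.
Lemma gwa_mulDl : left_distributive gwa_mul gwa_add.
Proof.
elim/quotW=> a; elim/quotW=> b; elim/quotW=> c.
rewrite -(pi_gadd a b) -(pi_gmul a c) -(pi_gmul b c).
rewrite -(pi_gmul (GAdd a b) c) -(pi_gadd (GMul a c)).
by apply/gwaE; exact: gc_mulDl.
Qed.
Lemma gwa_mulDr : right_distributive gwa_mul gwa_add.
Proof.
elim/quotW=> a; elim/quotW=> b; elim/quotW=> c.
rewrite -(pi_gadd b c) -(pi_gmul a b) -(pi_gmul a c).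
rewrite -(pi_gmul a (GAdd b c)) -(pi_gadd (GMul a b)).
by apply/gwaE; exact: gc_mulDr.
Qed.

HB.instance Definition _ := GRing.Zmodule_isPzRing.Build gwa
  gwa_mulA gwa_mul1l gwa_mul1r gwa_mulDl gwa_mulDr.

Definition gwaC (r : R) : gwa := \pi_gwa (GC r).
Definition gwaX : gwa := \pi_gwa GX.
Definition gwaY : gwa := \pi_gwa GY.

Lemma pi_gaddE a b : \pi_gwa (GAdd a b) = \pi_gwa a + \pi_gwa b.
Proof. exact: pi_gadd. Qed.
Lemma pi_gmulE a b : \pi_gwa (GMul a b) = \pi_gwa a * \pi_gwa b.
Proof. exact: pi_gmul. Qed.

Lemma gwaCD r s : gwaC (r + s) = gwaC r + gwaC s.
Proof. by rewrite -pi_gaddE; apply/gwaE; exact: gc_CD. Qed.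
Lemma gwaCM r s : gwaC (r * s) = gwaC r * gwaC s.
Proof. by rewrite -pi_gmulE; apply/gwaE; exact: gc_CM. Qed.
Lemma gwaC1 : gwaC 1 = 1. Proof. by []. Qed.
Lemma gwaXC r : gwaX * gwaC r = gwaC (sigma r) * gwaX.
Proof. by rewrite -!pi_gmulE; apply/gwaE; exact: gc_XC. Qed.
Lemma gwaYC r : gwaY * gwaC r = gwaC (raut_inv sigma r) * gwaY.
Proof. by rewrite -!pi_gmulE; apply/gwaE; exact: gc_YC. Qed.
Lemma gwaYX : gwaY * gwaX = gwaC t.
Proof. by rewrite -pi_gmulE; apply/gwaE; exact: gc_YX. Qed.
Lemma gwaXY : gwaX * gwaY = gwaC (sigma t).
Proof. by rewrite -pi_gmulE; apply/gwaE; exact: gc_XY. Qed.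

Record gwa_ops := GwaOps {
  ops_mod : lmodType R;
  opX : ops_mod -> ops_mod;
  opY : ops_mod -> ops_mod;
  opXD : {morph opX : u v / u + v};
  opYD : {morph opY : u v / u + v};
  opXZ : forall r u, opX (r *: u) = sigma r *: opX u;
  opYZ : forall r u, opY (r *: u) = raut_inv sigma r *: opY u;
  opYX : forall u, opY (opX u) = t *: u;
  opXY : forall u, opX (opY u) = sigma t *: u }.

Section OpsModule.
Variable D : gwa_ops.

Fixpoint geval (a : gexpr R) (v : ops_mod D) : ops_mod D :=
  match a with
  | GC r => r *: v
  | GX => opX v
  | GY => opY v
  | GAdd a b => geval a v + geval b v
  | GOpp a => - geval a v
  | GMul a b => geval a (geval b v)
  end.

Lemma gevalD a : {morph geval a : u v / u + v}.
Proof.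
elim: a => [r|||a IHa b IHb|a IHa|a IHa b IHb] u v /=.
- exact: scalerDr.
- exact: opXD.
- exact: opYD.
- by rewrite IHa IHb addrACA.
- by rewrite IHa opprD.
- by rewrite IHb IHa.
Qed.

Lemma geval_gcong a b : gcong a b -> geval a =1 geval b.
Proof.
elim=> //=.
- by move=> {}a {}b _ IH v; rewrite IH.
- by move=> {}a {}b c _ IH _ IH' v; rewrite IH IH'.
- by move=> ? ? ? ? _ IH _ IH' v; rewrite IH IH'.
- by move=> ? ? _ IH v; rewrite IH.
- by move=> ? ? ? ? _ IH _ IH' v; rewrite IH IH'.
- by move=> ? ? ? v; rewrite addrA.
- by move=> ? ? v; rewrite addrC.
- by move=> ? v; rewrite scale0r add0r.
- by move=> ? v; rewrite addNr scale0r.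
- by move=> ? v; rewrite scale1r.
- by move=> ? v; rewrite scale1r.
- by move=> ? ? ? v; rewrite gevalD.
- by move=> ? ? v; rewrite scalerDl.
- by move=> ? ? v; rewrite scalerA.
- by move=> ? v; rewrite opXZ.
- by move=> ? v; rewrite opYZ.
- by move=> v; rewrite opYX.
- by move=> v; rewrite opXY.
Qed.

(* The A(t)-module in which X and Y act by the given operators. *)
Definition gwa_module : Type := ops_mod D.
HB.instance Definition _ := GRing.Zmodule.on gwa_module.

Definition gwa_scale (a : gwa) (v : gwa_module) : gwa_module :=
  geval (repr a) v.

Lemma gwa_scale_pi a v : gwa_scale (\pi_gwa a) v = geval a v.
Proof. by apply: geval_gcong; exact: repr_gcong. Qed.

Lemma gwa_scaleA a b v : gwa_scale a (gwa_scale b v) = gwa_scale (a * b) v.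
Proof. elim/quotW: a => a; elim/quotW: b => b.
by rewrite -pi_gmulE !gwa_scale_pi. Qed.
Lemma gwa_scale1 : left_id 1 gwa_scale.
Proof. by move=> v; rewrite gwa_scale_pi /= scale1r. Qed.
Lemma gwa_scaleDr : right_distributive gwa_scale +%R.
Proof. by move=> a u v; exact: gevalD. Qed.
Lemma gwa_scaleDl v : {morph gwa_scale^~ v : a b / a + b}.
Proof. elim/quotW=> a; elim/quotW=> b.
by rewrite -pi_gaddE !gwa_scale_pi. Qed.

HB.instance Definition _ := GRing.Zmodule_isLmodule.Build gwa gwa_module
  gwa_scaleA gwa_scale1 gwa_scaleDr gwa_scaleDl.

Lemma gwaC_scale r (v : gwa_module) : gwaC r *: v = (r *: (v : ops_mod D)).
Proof. exact: gwa_scale_pi. Qed.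
Lemma gwaX_scale (v : gwa_module) : gwaX *: v = opX (v : ops_mod D).
Proof. exact: gwa_scale_pi. Qed.
Lemma gwaY_scale (v : gwa_module) : gwaY *: v = opY (v : ops_mod D).
Proof. exact: gwa_scale_pi. Qed.

End OpsModule.

Section Restrict.
Variable M : lmodType gwa.

(* M as an R-module, through R -> A(t). *)
Definition resR : Type := M.
HB.instance Definition _ := GRing.Zmodule.on resR.

Definition resR_scale (r : R) (v : resR) : resR := (gwaC r *: (v : M)).

Lemma resR_scaleA a b v : resR_scale a (resR_scale b v) = resR_scale (a * b) v.
Proof. by rewrite /resR_scale scalerA gwaCM. Qed.
Lemma resR_scale1 : left_id 1 resR_scale.
Proof. by move=> v; rewrite /resR_scale gwaC1 scale1r. Qed.
Lemma resR_scaleDr : right_distributive resR_scale +%R.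
Proof. by move=> a u v; rewrite /resR_scale scalerDr. Qed.
Lemma resR_scaleDl v : {morph resR_scale^~ v : a b / a + b}.
Proof. by move=> a b; rewrite /resR_scale gwaCD scalerDl. Qed.

HB.instance Definition _ := GRing.Zmodule_isLmodule.Build R resR
  resR_scaleA resR_scale1 resR_scaleDr resR_scaleDl.

Definition resX (v : resR) : resR := gwaX *: (v : M).
Definition resY (v : resR) : resR := gwaY *: (v : M).

Lemma resXD : {morph resX : u v / u + v}.
Proof. by move=> u v; exact: (@scalerDr _ M gwaX u v). Qed.
Lemma resYD : {morph resY : u v / u + v}.
Proof. by move=> u v; exact: (@scalerDr _ M gwaY u v). Qed.
Lemma resXZ r u : resX (r *: u) = sigma r *: resX u.
Proof.
by rewrite /resX [r *: u]/(resR_scale _ _) /resR_scale scalerA gwaXC -scalerA.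
Qed.
Lemma resYZ r u : resY (r *: u) = raut_inv sigma r *: resY u.
Proof.
by rewrite /resY [r *: u]/(resR_scale _ _) /resR_scale scalerA gwaYC -scalerA.
Qed.
Lemma resYX u : resY (resX u) = t *: u.
Proof. by rewrite /resX /resY scalerA gwaYX. Qed.
Lemma resXY u : resX (resY u) = sigma t *: u.
Proof. by rewrite /resX /resY scalerA gwaXY. Qed.

End Restrict.
End GWA.

Section Tensor.
Variables (R : comNzRingType) (M N : lmodType R).

(* A list stands for the sum of the simple tensors of its entries. The rule
   [tc_0] is needed since lists only form a monoid, without cancellation. *)
Inductive tcong : seq (M * N) -> seq (M * N) -> Prop :=
  | tc_refl s : tcong s s
  | tc_sym s1 s2 : tcong s1 s2 -> tcong s2 s1
  | tc_trans s1 s2 s3 : tcong s1 s2 -> tcong s2 s3 -> tcong s1 s3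
  | tc_cat s1 s1' s2 s2' : tcong s1 s1' -> tcong s2 s2' ->
      tcong (s1 ++ s2) (s1' ++ s2')
  | tc_catC s1 s2 : tcong (s1 ++ s2) (s2 ++ s1)
  | tc_0 v : tcong [:: (0, v)] [::]
  | tc_Dl u u' v : tcong [:: (u + u', v)] [:: (u, v); (u', v)]
  | tc_Dr u v v' : tcong [:: (u, v + v')] [:: (u, v); (u, v')]
  | tc_Z r u v : tcong [:: (r *: u, v)] [:: (u, r *: v)].

Definition tcongb (a b : seq (M * N)) : bool := `[< tcong a b >].

Lemma tcongb_equiv : equiv_class_of tcongb.
Proof.
split=> [a|a b|b a c].
- by apply/asboolP; exact: tc_refl.
- by apply/asboolP/asboolP; exact: tc_sym.
- move=> /asboolP ab /asboolP bc; apply/asboolP; exact: tc_trans ab bc.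
Qed.

Canonical tcongb_equivRel := EquivRelPack tcongb_equiv.

Definition tensor : Type := {eq_quot tcongb}.

HB.instance Definition _ := Choice.on tensor.
HB.instance Definition _ := EqQuotient.on tensor.

Lemma tensorE a b : tcong a b <-> \pi_tensor a = \pi_tensor b.
Proof.
split=> [h|/eqP]; first by apply/eqP; rewrite eqmodE; apply/asboolP.
by rewrite eqmodE => /asboolP.
Qed.

Lemma repr_tcong a : tcong (repr (\pi_tensor a)) a.
Proof. by apply/tensorE; rewrite reprK. Qed.

Definition ttens (u : M) (v : N) : tensor := \pi_tensor [:: (u, v)].

Definition tens_add (a b : tensor) : tensor := \pi_tensor (repr a ++ repr b).
Lemma pi_cat a b : \pi_tensor (a ++ b) = tens_add (\pi_tensor a) (\pi_tensor b).
Proof. by apply/tensorE; apply: tc_cat; apply: tc_sym; exact: repr_tcong. Qed.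

Definition semilin (tau : R -> R) (V W : lmodType R) (f : V -> W) : Prop :=
  {morph f : u v / u + v} /\ forall r u, f (r *: u) = tau r *: f u.

End Tensor.

Lemma semilin0 (R : comNzRingType) (tau : R -> R) (V W : lmodType R)
  (f : V -> W) : semilin tau f -> f 0 = 0.
Proof. by case=> fD _; apply: (addrI (f 0)); rewrite -fD !addr0. Qed.

Section TensorMap.
Variables (R : comNzRingType) (M N M' N' : lmodType R).

Definition list_map (f : M -> M') (g : N -> N') (s : seq (M * N)) :
  seq (M' * N') := [seq (f uv.1, g uv.2) | uv <- s].

(* [tens_map f g] sends u (x) v to f u (x) g v whenever f and g are additive
   and semilinear for the same tau (see [tens_map_tens]). *)
Definition tens_map (f : M -> M') (g : N -> N') (z : tensor M N) :
  tensor M' N' := \pi_(tensor M' N') (list_map f g (repr z)).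

Section WellDefined.
Variables (tau : R -> R) (f : M -> M') (g : N -> N').
Hypotheses (Hf : semilin tau f) (Hg : semilin tau g).

Lemma list_map_tcong a b :
  tcong a b -> tcong (list_map f g a) (list_map f g b).
Proof.
elim.
- by move=> s; exact: tc_refl.
- by move=> s1 s2 _; exact: tc_sym.
- by move=> s1 s2 s3 _ h1 _; exact: tc_trans.
- by move=> s1 s1' s2 s2' _ h1 _ h2; rewrite /list_map !map_cat; exact: tc_cat.
- by move=> s1 s2; rewrite /list_map !map_cat; exact: tc_catC.
- by move=> v /=; rewrite /list_map /= (semilin0 Hf); exact: tc_0.
- by move=> u u' v; rewrite /list_map /= Hf.1; exact: tc_Dl.
- by move=> u v v'; rewrite /list_map /= Hg.1; exact: tc_Dr.
- by move=> r u v; rewrite /list_map /= Hf.2 Hg.2; exact: tc_Z.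
Qed.

Lemma tens_map_pi a :
  tens_map f g (\pi_(tensor M N) a) = \pi_(tensor M' N') (list_map f g a).
Proof. by apply/tensorE/list_map_tcong/repr_tcong. Qed.

Lemma tens_map_tens u v : tens_map f g (ttens u v) = ttens (f u) (g v).
Proof. by rewrite tens_map_pi. Qed.

Lemma tens_map_add : {morph tens_map f g : a b / tens_add a b}.
Proof.
elim/quotW=> a; elim/quotW=> b; rewrite -pi_cat !tens_map_pi -pi_cat.
by rewrite /list_map map_cat.
Qed.

End WellDefined.
End TensorMap.

Section TensorModule.
Variables (R : comNzRingType) (M N : lmodType R).
Local Notation T := (tensor M N).

Lemma tens_addA : associative (@tens_add R M N).
Proof.
elim/quotW=> a; elim/quotW=> b; elim/quotW=> c.
by rewrite -(pi_cat b c) -(pi_cat a b) -!pi_cat catA.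
Qed.
Lemma tens_addC : commutative (@tens_add R M N).
Proof.
by elim/quotW=> a; elim/quotW=> b; rewrite -!pi_cat; apply/tensorE; exact: tc_catC.
Qed.
Lemma tens_add0 : left_id (\pi_T [::]) (@tens_add R M N).
Proof. by elim/quotW=> a; rewrite -pi_cat. Qed.

Definition tens_scale (r : R) : T -> T := tens_map ( *:%R r) id.

Lemma semilin_scale r (V : lmodType R) : semilin id ( *:%R r : V -> V).
Proof.
split=> [u v|s u]; first exact: scalerDr.
by rewrite !scalerA mulrC.
Qed.
Lemma semilin_id (V : lmodType R) : semilin id (id : V -> V).
Proof. by split. Qed.

Lemma tens_scale_pi r a :
  tens_scale r (\pi_T a) = \pi_T (list_map ( *:%R r) id a).
Proof.
by rewrite /tens_scale (tens_map_pi (semilin_scale r M) (semilin_id N)).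
Qed.

Lemma tens_scale_add r : {morph tens_scale r : a b / tens_add a b}.
Proof. exact: (tens_map_add (semilin_scale r M) (semilin_id N)). Qed.

Lemma tens_ind (P : T -> Prop) :
  P (\pi_T [::]) -> (forall u v, P (ttens u v)) ->
  (forall a b, P a -> P b -> P (tens_add a b)) -> forall a, P a.
Proof.
move=> P0 P1 PD; elim/quotW; elim => [//|[u v] s IH].
by rewrite -cat1s pi_cat; apply: PD => //; exact: P1.
Qed.

Lemma tens_scale_nil r : tens_scale r (\pi_T [::]) = \pi_T [::].
Proof. by rewrite tens_scale_pi. Qed.
Lemma tens_scale_tens r u v : tens_scale r (ttens u v) = ttens (r *: u) v.
Proof. by rewrite tens_scale_pi. Qed.

Lemma tens_addACA : interchange (@tens_add R M N) (@tens_add R M N).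
Proof.
by move=> a b c d; rewrite !tens_addA -(tens_addA a) (tens_addC b) !tens_addA.
Qed.

Lemma tens_scaleDl0 z r s :
  tens_scale (r + s) z = tens_add (tens_scale r z) (tens_scale s z).
Proof.
elim/tens_ind: z => [|u v|a b IHa IHb].
- by rewrite !tens_scale_nil -pi_cat.
- by rewrite !tens_scale_tens scalerDl -pi_cat; apply/tensorE; exact: tc_Dl.
- by rewrite !tens_scale_add IHa IHb tens_addACA.
Qed.

Lemma tens_scale0 z : tens_scale 0 z = \pi_T [::].
Proof.
elim/tens_ind: z => [|u v|a b IHa IHb].
- exact: tens_scale_nil.
- by rewrite tens_scale_tens scale0r; apply/tensorE; exact: tc_0.
- by rewrite tens_scale_add IHa IHb -pi_cat.
Qed.

Lemma tens_scale1 : left_id 1 tens_scale.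
Proof.
move=> z; elim/tens_ind: z => [|u v|a b IHa IHb].
- exact: tens_scale_nil.
- by rewrite tens_scale_tens scale1r.
- by rewrite tens_scale_add IHa IHb.
Qed.

Lemma tens_addN :
  left_inverse (\pi_T [::]) (tens_scale (-1)) (@tens_add R M N).
Proof.
by move=> z; rewrite -{2}(tens_scale1 z) -tens_scaleDl0 addNr tens_scale0.
Qed.

HB.instance Definition _ := GRing.isZmodule.Build (tensor M N)
  tens_addA tens_addC tens_add0 tens_addN.

Lemma tens_scaleA a b v :
  tens_scale a (tens_scale b v) = tens_scale (a * b) v.
Proof.
elim/tens_ind: v => [|u v|x y IHx IHy].
- by rewrite !tens_scale_nil.
- by rewrite !tens_scale_tens scalerA.
- by rewrite !tens_scale_add IHx IHy.
Qed.
Lemma tens_scaleDr : right_distributive tens_scale +%R.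
Proof. by move=> a; exact: tens_scale_add. Qed.
Lemma tens_scaleDl v : {morph tens_scale^~ v : a b / a + b}.
Proof. by move=> a b; exact: tens_scaleDl0. Qed.

HB.instance Definition _ := GRing.Zmodule_isLmodule.Build R (tensor M N)
  tens_scaleA tens_scale1 tens_scaleDr tens_scaleDl.

Lemma ttens_Zl r u v : ttens (r *: u) v = r *: (ttens u v : T).
Proof. by rewrite -tens_scale_tens. Qed.
Lemma ttens_Zr r u v : ttens u (r *: v) = r *: (ttens u v : T).
Proof. by rewrite -ttens_Zl; apply/esym/tensorE; exact: tc_Z. Qed.

Lemma tensor_ind (P : T -> Prop) :
  (forall u v, P (ttens u v)) ->
  (forall a b, P a -> P b -> P (a + b)) -> forall a, P a.
Proof.
move=> P1 PD; apply: tens_ind => //.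
have <- : \pi_T [:: (0, 0)] = \pi_T [::] by apply/tensorE; exact: tc_0.
exact: P1.
Qed.

End TensorModule.

Lemma tens_mapZ (R : comNzRingType) (M N M' N' : lmodType R) (tau : R -> R)
  (f : M -> M') (g : N -> N') : semilin tau f -> semilin tau g ->
  forall r (z : tensor M N), tens_map f g (r *: z) = tau r *: tens_map f g z.
Proof.
move=> Hf Hg r; elim/tensor_ind => [u v|a b IHa IHb].
  rewrite -ttens_Zl !(tens_map_tens Hf Hg) Hf.2; exact: ttens_Zl.
by rewrite scalerDr !(tens_map_add Hf Hg) scalerDr IHa IHb.
Qed.

Section TensorGWA.
Variables (R : comNzRingType) (sigma : raut R) (t t' : R).
Variables (M : lmodType (gwa sigma t)) (N : lmodType (gwa sigma t')).
Local Notation T := (tensor (resR M) (resR N)).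

Let HX (s : R) (L : lmodType (gwa sigma s)) : semilin sigma (@resX R sigma s L).
Proof. by split; [exact: resXD|exact: resXZ]. Qed.
Let HY (s : R) (L : lmodType (gwa sigma s)) :
  semilin (raut_inv sigma) (@resY R sigma s L).
Proof. by split; [exact: resYD|exact: resYZ]. Qed.

Definition tensX : T -> T := tens_map (@resX _ _ _ M) (@resX _ _ _ N).
Definition tensY : T -> T := tens_map (@resY _ _ _ M) (@resY _ _ _ N).

Lemma tensXD : {morph tensX : u v / u + v}.
Proof. exact: (tens_map_add (HX M) (HX N)). Qed.
Lemma tensYD : {morph tensY : u v / u + v}.
Proof. exact: (tens_map_add (HY M) (HY N)). Qed.
Lemma tensXZ r u : tensX (r *: u) = sigma r *: tensX u.
Proof. exact: (tens_mapZ (HX M) (HX N)). Qed.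
Lemma tensYZ r u : tensY (r *: u) = raut_inv sigma r *: tensY u.
Proof. exact: (tens_mapZ (HY M) (HY N)). Qed.
Lemma tensX_tens u v : tensX (ttens u v) = ttens (resX u) (resX v).
Proof. exact: (tens_map_tens (HX M) (HX N)). Qed.
Lemma tensY_tens u v : tensY (ttens u v) = ttens (resY u) (resY v).
Proof. exact: (tens_map_tens (HY M) (HY N)). Qed.
Lemma tensYX u : tensY (tensX u) = (t * t') *: u.
Proof.
elim/tensor_ind: u => [u v|a b IHa IHb].
  by rewrite tensX_tens tensY_tens !resYX ttens_Zl ttens_Zr scalerA.
by rewrite tensXD tensYD IHa IHb scalerDr.
Qed.
Lemma tensXY u : tensX (tensY u) = sigma (t * t') *: u.
Proof.
elim/tensor_ind: u => [u v|a b IHa IHb].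
  by rewrite tensY_tens tensX_tens !resXY ttens_Zl ttens_Zr scalerA rmorphM.
by rewrite tensYD tensXD IHa IHb scalerDr.
Qed.

Definition tensor_ops : gwa_ops sigma (t * t') :=
  GwaOps tensXD tensYD tensXZ tensYZ tensYX tensXY.

(* M (x)_R N over A(tt'), with X and Y acting diagonally on simple tensors;
   see [tensX_tens] and [tensY_tens]. *)
Definition gwa_tensor : lmodType (gwa sigma (t * t')) :=
  gwa_module tensor_ops.

End TensorGWA.

Section DirectSum.
Variables (R : comNzRingType) (I : finType) (m_ : I -> maxSpec R).

Definition dsum : Type := forall i : I, residue (m_ i).

HB.instance Definition _ := gen_eqMixin dsum.
HB.instance Definition _ := gen_choiceMixin dsum.

Let ds0 : dsum := fun=> 0.
Let dsN (u : dsum) : dsum := fun i => - u i.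
Let dsD (u v : dsum) : dsum := fun i => u i + v i.
Let dsZ (r : R) (u : dsum) : dsum := fun i => r *: u i.

Lemma dsDA : associative dsD.
Proof. by move=> u v w; apply: functional_extensionality_dep => i; exact: addrA. Qed.
Lemma dsDC : commutative dsD.
Proof. by move=> u v; apply: functional_extensionality_dep => i; exact: addrC. Qed.
Lemma dsD0 : left_id ds0 dsD.
Proof. by move=> u; apply: functional_extensionality_dep => i; exact: add0r. Qed.
Lemma dsDN : left_inverse ds0 dsN dsD.
Proof. by move=> u; apply: functional_extensionality_dep => i; exact: addNr. Qed.

HB.instance Definition _ := GRing.isZmodule.Build dsum dsDA dsDC dsD0 dsDN.

Lemma dsZA a b v : dsZ a (dsZ b v) = dsZ (a * b) v.
Proof. by apply: functional_extensionality_dep => i; exact: scalerA. Qed.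
Lemma dsZ1 : left_id 1 dsZ.
Proof. by move=> u; apply: functional_extensionality_dep => i; exact: scale1r. Qed.
Lemma dsZDr : right_distributive dsZ +%R.
Proof. by move=> a u v; apply: functional_extensionality_dep => i; exact: scalerDr. Qed.
Lemma dsZDl v : {morph dsZ^~ v : a b / a + b}.
Proof. by move=> a b; apply: functional_extensionality_dep => i; exact: scalerDl. Qed.

HB.instance Definition _ :=
  GRing.Zmodule_isLmodule.Build R dsum dsZA dsZ1 dsZDr dsZDl.

Lemma dsumDE (u v : dsum) i : (u + v) i = u i + v i. Proof. by []. Qed.
Lemma dsumZE r (u : dsum) i : (r *: u) i = r *: u i. Proof. by []. Qed.
Lemma dsum0E i : (0 : dsum) i = 0. Proof. by []. Qed.

Lemma dsum_sumE (J : Type) (s : seq J) (P : pred J) (F : J -> dsum) i :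
  (\sum_(j <- s | P j) F j) i = \sum_(j <- s | P j) F j i.
Proof. by apply: (big_morph (fun u : dsum => u i)). Qed.

Lemma dsumP (u v : dsum) : (forall i, u i = v i) -> u = v.
Proof. exact: functional_extensionality_dep. Qed.

Lemma residue_scale_eq0 (m : maxSpec R) r (x : residue m) :
  r \in mideal m -> r *: x = 0.
Proof.
by move=> /pires0 rm; rewrite [LHS]/(residue_scale r x) /residue_scale rm mul0r.
Qed.

Definition dbasis (i : I) : dsum := fun j => (j == i)%:R.

Lemma dbasisZ0 r i : r \in mideal (m_ i) -> r *: dbasis i = 0.
Proof.
move=> rm; apply: dsumP => j; rewrite dsumZE /dbasis.
case: eqP => [->|_]; last exact: scaler0.
exact: residue_scale_eq0.
Qed.

Lemma repr_scale (m : maxSpec R) (x : residue m) : repr x *: (1 : residue m) = x.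
Proof. by rewrite [LHS]/(residue_scale _ _) /residue_scale reprK mulr1. Qed.

Lemma dsum_basisE (v : dsum) : v = \sum_i repr (v i) *: dbasis i.
Proof.
apply: dsumP => j; rewrite dsum_sumE (bigD1 j) //= big1 => [|i ij].
  by rewrite addr0 dsumZE /dbasis eqxx repr_scale.
by rewrite dsumZE /dbasis eq_sym (negbTE ij) scaler0.
Qed.

Section SemiExt.
Variables (V : lmodType R) (tau : R -> R).

(* The tau-semilinear extension of e_i |-> u i, which is well defined as soon
   as tau(m_i) annihilates u i (see [semiext_basis], [semiext_semilin]). *)
Definition semiext (u : I -> V) (v : dsum) : V :=
  \sum_i tau (repr (v i)) *: u i.

Hypotheses (tauD : {morph tau : x y / x + y}) (tauM : {morph tau : x y / x * y}).
Hypothesis tau1 : tau 1 = 1.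
Variable u : I -> V.
Hypothesis Hu : forall i r, r \in mideal (m_ i) -> tau r *: u i = 0.

Lemma tau_eq i (r s : R) :
  \pi_(residue (m_ i)) r = \pi_(residue (m_ i)) s -> tau r *: u i = tau s *: u i.
Proof.
move=> /piresE rs; rewrite -(subrK s r) tauD scalerDl Hu ?add0r //.
Qed.

Lemma semiext_semilin : semilin tau (semiext u).
Proof.
split=> [v w|r v]; rewrite /semiext.
  rewrite -big_split; apply: eq_bigr => i _; rewrite /= -scalerDl -tauD.
  by apply: tau_eq; rewrite piresD !reprK.
rewrite scaler_sumr; apply: eq_bigr => i _; rewrite scalerA -tauM.
by apply: tau_eq; rewrite piresM !reprK.
Qed.

Lemma semiext_basis i : semiext u (dbasis i) = u i.
Proof.
rewrite /semiext (bigD1 i) //= big1 => [|j ji].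
  rewrite addr0 -[RHS]scale1r -tau1; apply: tau_eq.
  by rewrite reprK /dbasis eqxx pires1.
apply: Hu; apply/pires0; rewrite reprK /dbasis (negbTE ji) //.
Qed.

End SemiExt.

Lemma semilin_eq (V : lmodType R) (tau : R -> R) (f g : dsum -> V) :
  semilin tau f -> semilin tau g ->
  (forall i, f (dbasis i) = g (dbasis i)) -> f =1 g.
Proof.
move=> Hf Hg fg v; rewrite [v]dsum_basisE.
rewrite (big_morph f Hf.1 (semilin0 Hf)) (big_morph g Hg.1 (semilin0 Hg)).
by apply: eq_bigr => i _; rewrite Hf.2 Hg.2 fg.
Qed.

End DirectSum.

Section BasisOps.
Variables (R : comNzRingType) (sigma : raut R) (t : R).
Variables (I : finType) (m_ : I -> maxSpec R).
Variables (Xe Ye : I -> dsum m_).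
Local Notation V := (dsum m_).
Local Notation sigV := (raut_inv sigma).

Hypothesis HX : forall i r, r \in mideal (m_ i) -> sigma r *: Xe i = 0.
Hypothesis HY : forall i r, r \in mideal (m_ i) -> sigV r *: Ye i = 0.
Local Notation X := (semiext (m_ := m_) sigma Xe).
Local Notation Y := (semiext (m_ := m_) sigV Ye).
Hypothesis HYX : forall i, Y (Xe i) = t *: dbasis m_ i.
Hypothesis HXY : forall i, X (Ye i) = sigma t *: dbasis m_ i.

Lemma basisX : semilin sigma X.
Proof. by apply: semiext_semilin => //; [exact: rmorphD|exact: rmorphM]. Qed.
Lemma basisY : semilin sigV Y.
Proof. by apply: semiext_semilin => //; [exact: raut_invD|exact: raut_invM]. Qed.

Lemma basisYX u : Y (X u) = t *: u.
Proof.
move: u; apply: (semilin_eq (tau := id)).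
- split=> [u v|r u]; first by rewrite basisX.1 basisY.1.
  by rewrite basisX.2 basisY.2 rautK.
- exact: semilin_scale.
- by move=> i; rewrite semiext_basis //; [exact: rmorphD|exact: rmorph1].
Qed.

Lemma basisXY u : X (Y u) = sigma t *: u.
Proof.
move: u; apply: (semilin_eq (tau := id)).
- split=> [u v|r u]; first by rewrite basisY.1 basisX.1.
  by rewrite basisY.2 basisX.2 rautVK.
- exact: semilin_scale.
- by move=> i; rewrite semiext_basis //; [exact: raut_invD|exact: raut_inv1].
Qed.

Definition basis_ops : gwa_ops sigma t :=
  GwaOps basisX.1 basisY.1 basisX.2 basisY.2 basisYX basisXY.

End BasisOps.

Inductive letter := L1 | Lx | Ly | L0.

Section WordModule.
Variables (R : comNzRingType) (sigma : raut R) (m0 : maxSpec R) (p : nat).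
Local Notation "''m_' k" := (sigmak sigma m0 k) (at level 8, k at level 2).

(* An indexed word w_j w_(j+1) ... is a starting index j together with the
   list of its letters; [letter_at j w k] is the letter w_k. *)
Definition letter_at (j : nat) (w : seq letter) (k : nat) : letter :=
  nth L0 w (k - j).

(* The word w_j w_(j+1) ... lies in D^t_omega. *)
Definition in_D (t : R) (j : nat) (w : seq letter) : Prop :=
  forall k, (j <= k < j + size w)%N ->
    (letter_at j w k = L1 <-> ~ break_set sigma m0 p t ('m_k)).

(* The conditions under which V^t(omega, i, w) is defined. *)
Record word_ok (t : R) (i : nat) (w : seq letter) : Prop := WordOk {
  word_i : (i < p)%N;
  word_left : break_set sigma m0 p t ('m_i);
  word_D : in_D t i.+1 w;
  word_right : break_set sigma m0 p t ('m_(i + size w + 1)) }.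

Section Space.
Variables (t : R) (i : nat) (w : seq letter).

(* The position j : 'I_(size w).+1 carries the basis vector e_(i+1+j). *)
Definition word_ideal (j : 'I_(size w).+1) : maxSpec R := 'm_(i.+1 + j).
Definition word_space : Type := dsum word_ideal.
HB.instance Definition _ := GRing.Lmodule.on word_space.

Definition word_e (k : nat) : word_space :=
  fun j => ((i.+1 + j)%N == k)%:R.

Definition word_Xe (k : nat) : word_space :=
  if k == (i + size w + 1)%N then 0 else
  match letter_at i.+1 w k with
  | L1 => sigma t *: word_e k.+1
  | Lx => word_e k.+1
  | Ly | L0 => 0
  end.

Definition word_Ye (k : nat) : word_space :=
  if k == i.+1 then 0 else
  match letter_at i.+1 w k.-1 with
  | L1 | Ly => word_e k.-1
  | Lx | L0 => 0
  end.


Lemma word_eE (j : 'I_(size w).+1) :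
  word_e (i.+1 + j) = dbasis word_ideal j.
Proof. by apply: dsumP => l; rewrite /word_e /dbasis eqn_add2l. Qed.

Lemma word_e_ann k r : r \in mideal ('m_k) -> r *: word_e k = 0.
Proof.
move=> rk; apply: dsumP => l; rewrite dsumZE /word_e.
case: eqP => [E|_]; last exact: scaler0.
by apply: residue_scale_eq0; rewrite /word_ideal E.
Qed.

Let Xe (j : 'I_(size w).+1) : dsum word_ideal := word_Xe (i.+1 + j).
Let Ye (j : 'I_(size w).+1) : dsum word_ideal := word_Ye (i.+1 + j).

Lemma word_HX j r : r \in mideal (word_ideal j) -> sigma r *: Xe j = 0.
Proof.
move=> rj; have rj' : sigma r \in mideal ('m_((i.+1 + j).+1)).
  by rewrite inE rautK.
rewrite /Xe /word_Xe; case: ifP => _; first exact: scaler0.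
case: letter_at; rewrite ?scaler0 //; last exact: word_e_ann.
by rewrite scalerA mulrC -scalerA word_e_ann ?scaler0.
Qed.

Lemma word_HY j r :
  r \in mideal (word_ideal j) -> raut_inv sigma r *: Ye j = 0.
Proof.
rewrite /word_ideal addSn => rj.
have rj' : raut_inv sigma r \in mideal ('m_(i + j)) by [].
rewrite /Ye /word_Ye; case: ifP => _; first exact: scaler0.
by case: letter_at; rewrite ?scaler0 // addSn; exact: word_e_ann.
Qed.

Let sX := semiext (m_ := word_ideal) sigma Xe.
Let sY := semiext (m_ := word_ideal) (raut_inv sigma) Ye.

Let sX_lin : semilin sigma sX. Proof. exact: basisX word_HX. Qed.
Let sY_lin : semilin (raut_inv sigma) sY. Proof. exact: basisY word_HY. Qed.

Let sX_e k : (i.+1 <= k < i.+1 + (size w).+1)%N -> sX (word_e k) = word_Xe k.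
Proof.
case/andP=> ik; rewrite -{1 2 3}(subnKC ik) ltn_add2l => kj.
rewrite (word_eE (Ordinal kj)) /sX semiext_basis //=.
- exact: rmorphD.
- exact: rmorph1.
- exact: word_HX.
Qed.

Let sY_e k : (i.+1 <= k < i.+1 + (size w).+1)%N -> sY (word_e k) = word_Ye k.
Proof.
case/andP=> ik; rewrite -{1 2 3}(subnKC ik) ltn_add2l => kj.
rewrite (word_eE (Ordinal kj)) /sY semiext_basis //=.
- exact: raut_invD.
- exact: raut_inv1.
- exact: word_HY.
Qed.

Hypothesis hw : word_ok t i w.

Let not1 k : (i.+1 <= k < i.+1 + size w)%N -> letter_at i.+1 w k <> L1 ->
  t \in mideal ('m_k).
Proof.
move=> ik; have [_ h] := word_D hw ik => n1.
by have [] : break_set sigma m0 p t ('m_k) by apply: contrapT => /h.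
Qed.

Lemma word_HYX j : sY (Xe j) = t *: dbasis word_ideal j.
Proof.
rewrite -word_eE /Xe; set k := (i.+1 + j)%N.
have k_lo : (i.+1 <= k)%N by exact: leq_addr.
have k_hi : (k < i.+1 + (size w).+1)%N by rewrite ltn_add2l.
rewrite /word_Xe; case: eqP => [kE|/eqP kE].
  rewrite (semilin0 sY_lin) word_e_ann // kE.
  by case: (word_right hw).
have k_in : (i.+1 <= k < i.+1 + size w)%N.
  rewrite k_lo ltn_neqAle; move: kE k_hi.
  by rewrite addn1 -addSn => ->; rewrite addnS ltnS.
have Sk_in : (i.+1 <= k.+1 < i.+1 + (size w).+1)%N.
  by case/andP: k_in => _ hk; apply/andP; split; [exact: leqW|rewrite addnS ltnS].
have Sk_ne : (k.+1 == i.+1) = false.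
  by rewrite eqn_leq ltnNge k_lo.
case El : (letter_at i.+1 w k).
- by rewrite sY_lin.2 rautK (sY_e Sk_in) /word_Ye Sk_ne /= El.
- rewrite (sY_e Sk_in) /word_Ye Sk_ne /= El word_e_ann //.
  by apply: not1 k_in _; rewrite El.
- by rewrite (semilin0 sY_lin) word_e_ann //; apply: not1 k_in _; rewrite El.
- by rewrite (semilin0 sY_lin) word_e_ann //; apply: not1 k_in _; rewrite El.
Qed.

Lemma word_HXY j : sX (Ye j) = sigma t *: dbasis word_ideal j.
Proof.
rewrite -word_eE /Ye addSn; set k := (i + j)%N.
have k_lo : (i <= k)%N by exact: leq_addr.
have k_hi : (k < i + (size w).+1)%N by rewrite ltn_add2l.
have ann : t \in mideal ('m_k) -> sigma t *: word_e k.+1 = 0.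
  by move=> tk; apply: word_e_ann; rewrite inE rautK.
rewrite /word_Ye /=; case: eqP => [[kE]|/eqP kE].
  rewrite (semilin0 sX_lin) ann // kE.
  by case: (word_left hw).
have k_lt : (i < k)%N by rewrite ltn_neqAle k_lo eq_sym -eqSS kE.
have k_in : (i.+1 <= k < i.+1 + size w)%N by rewrite k_lt addSn -addnS.
have k_in' : (i.+1 <= k < i.+1 + (size w).+1)%N.
  by rewrite k_lt addnS ltnW // ltnS; case/andP: k_in.
have k_ne : (k == (i + size w + 1)%N) = false.
  by rewrite ltn_eqF // addn1 -addnS.
case El : (letter_at i.+1 w k).
- by rewrite (sX_e k_in') /word_Xe k_ne El.
- by rewrite (semilin0 sX_lin) ann //; apply: not1 k_in _; rewrite El.
- rewrite (sX_e k_in') /word_Xe k_ne El ann //.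
  by apply: not1 k_in _; rewrite El.
- by rewrite (semilin0 sX_lin) ann //; apply: not1 k_in _; rewrite El.
Qed.

Definition word_ops : gwa_ops sigma t :=
  basis_ops word_HX word_HY word_HYX word_HXY.

(* V^t(omega, i, w): [word_Xe k] and [word_Ye k] are X e_k and Y e_k, extended
   semilinearly; see [V_word_X] and [V_word_Y]. *)
Definition V_word : lmodType (gwa sigma t) := gwa_module word_ops.

Lemma V_word_X k : (i.+1 <= k < i.+1 + (size w).+1)%N ->
  gwaX sigma t *: (word_e k : V_word) = word_Xe k.
Proof. by move=> hk; rewrite (@gwaX_scale _ _ _ word_ops) -(sX_e hk). Qed.

Lemma V_word_Y k : (i.+1 <= k < i.+1 + (size w).+1)%N ->
  gwaY sigma t *: (word_e k : V_word) = word_Ye k.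
Proof. by move=> hk; rewrite (@gwaY_scale _ _ _ word_ops) -(sY_e hk). Qed.

End Space.

End WordModule.

Section CyclicModule.
Variables (R : comNzRingType) (sigma : raut R) (m0 : maxSpec R) (p : nat).
Hypothesis sigma_p : forall r, iter p sigma r = r.
Variables (t : R) (d : nat) (F : 'M[residue m0]_d).
Hypothesis F_unit : F \in unitmx.
Local Notation "''m_' k" := (sigmak sigma m0 k) (at level 8, k at level 2).

Lemma sigmak_p : 'm_p = m0.
Proof.
apply: maxSpec_eq => x.
have sk k y : (iter k sigma y \in mideal ('m_k)) = (y \in mideal m0).
  by elim: k => //= k IH; rewrite inE rautK.
by rewrite -{1}(sigma_p x) sk.
Qed.

(* The position (j, s) carries the basis vector e_(j+1, s+1); [cyc_e k s]
   takes k from 1 to p and s in 'I_d. *)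
Definition cyc_ideal (js : 'I_p * 'I_d) : maxSpec R := 'm_(js.1.+1).
Definition cyc_space : Type := dsum cyc_ideal.
HB.instance Definition _ := GRing.Lmodule.on cyc_space.

Definition cyc_e (k : nat) (s : 'I_d) : cyc_space :=
  fun js => ((js.1.+1 == k) && (js.2 == s))%:R.

Definition sigmaF : 'M[residue (sigma_max sigma m0)]_d :=
  map_mx (@sigma_res R sigma m0) F.

(* Matrices act on column vectors. An element of R/sigma(m_0) acts on
   e_(1,r), and one of R/m_0 = R/sigma^p(m_0) on e_(p,r), through any
   representative in R. *)
Definition cyc_Xe (k : nat) (s : 'I_d) : cyc_space :=
  if k == p then sigma t *: \sum_r repr (sigmaF r s) *: cyc_e 1 r
  else sigma t *: cyc_e k.+1 s.

Definition cyc_Ye (k : nat) (s : 'I_d) : cyc_space :=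
  if k == 1%N then \sum_r repr (invmx F r s) *: cyc_e p r
  else cyc_e k.-1 s.

Let Xe (js : 'I_p * 'I_d) : dsum cyc_ideal := cyc_Xe js.1.+1 js.2.
Let Ye (js : 'I_p * 'I_d) : dsum cyc_ideal := cyc_Ye js.1.+1 js.2.

Lemma cyc_eE (js : 'I_p * 'I_d) : cyc_e js.1.+1 js.2 = dbasis cyc_ideal js.
Proof. by apply: dsumP => l; rewrite /cyc_e /dbasis eqSS -xpair_eqE. Qed.

Lemma cyc_e_ann k s r : r \in mideal ('m_k) -> r *: cyc_e k s = 0.
Proof.
move=> rk; apply: dsumP => l; rewrite dsumZE /cyc_e.
case: eqP => [E|_]; last exact: scaler0.
by apply: residue_scale_eq0; rewrite /cyc_ideal E.
Qed.

Lemma cyc_HX js r : r \in mideal (cyc_ideal js) -> sigma r *: Xe js = 0.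
Proof.
rewrite /cyc_ideal => rj.
have rj' : sigma r \in mideal ('m_(js.1.+2)) by rewrite inE rautK.
rewrite /Xe /cyc_Xe; case: eqP => [E|_]; last first.
  by rewrite scalerA mulrC -scalerA cyc_e_ann ?scaler0.
have r1 : sigma r \in mideal ('m_1).
  by move: rj; rewrite E sigmak_p inE rautK.
rewrite scalerA mulrC -scalerA scaler_sumr big1 ?scaler0 // => l _.
by rewrite scalerA mulrC -scalerA cyc_e_ann ?scaler0.
Qed.

Lemma cyc_HY js r : r \in mideal (cyc_ideal js) -> raut_inv sigma r *: Ye js = 0.
Proof.
rewrite /cyc_ideal => rj.
have rj' : raut_inv sigma r \in mideal ('m_(js.1)) by [].
rewrite /Ye /cyc_Ye; case: eqP => [[E]|_]; last by rewrite cyc_e_ann.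
rewrite scaler_sumr big1 // => l _.
rewrite scalerA mulrC -scalerA cyc_e_ann ?scaler0 //.
by rewrite sigmak_p; move: rj'; rewrite E.
Qed.

Let sX := semiext (m_ := cyc_ideal) sigma Xe.
Let sY := semiext (m_ := cyc_ideal) (raut_inv sigma) Ye.

Let sX_lin : semilin sigma sX. Proof. exact: basisX cyc_HX. Qed.
Let sY_lin : semilin (raut_inv sigma) sY. Proof. exact: basisY cyc_HY. Qed.

Let sX_e k s : (0 < k <= p)%N -> sX (cyc_e k s) = cyc_Xe k s.
Proof.
case: k => // k kp; rewrite (cyc_eE (Ordinal kp, s)) /sX semiext_basis //.
- exact: rmorphD.
- exact: rmorph1.
- exact: cyc_HX.
Qed.

Let sY_e k s : (0 < k <= p)%N -> sY (cyc_e k s) = cyc_Ye k s.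
Proof.
case: k => // k kp; rewrite (cyc_eE (Ordinal kp, s)) /sY semiext_basis //.
- exact: raut_invD.
- exact: raut_inv1.
- exact: cyc_HY.
Qed.

Let scale_congr k s a b : a - b \in mideal ('m_k) ->
  a *: cyc_e k s = b *: cyc_e k s.
Proof.
by move=> ab; apply/eqP; rewrite -subr_eq0 -scalerBl cyc_e_ann.
Qed.

Let collapse k s (a : 'I_d -> 'I_d -> R) (b : 'I_d -> R) :
  (forall l, \sum_r b r * a l r - (l == s)%:R \in mideal ('m_k)) ->
  \sum_r b r *: (\sum_l a l r *: cyc_e k l) = cyc_e k s.
Proof.
move=> h.
under eq_bigr do rewrite scaler_sumr.
rewrite exchange_big /=.
transitivity (\sum_l (l == s)%:R *: cyc_e k l).
  apply: eq_bigr => l _.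
  under eq_bigr do rewrite scalerA.
  by rewrite -scaler_suml; apply: scale_congr.
rewrite (bigD1 s) //= eqxx scale1r big1 ?addr0 // => l /negbTE ->.
exact: scale0r.
Qed.

Let pires_sum (m : maxSpec R) (J : finType) (f : J -> R) :
  \pi_(residue m) (\sum_j f j) = \sum_j \pi_(residue m) (f j).
Proof. by apply: big_morph; [exact: piresD|apply/pires0; exact: rpred0]. Qed.

Let mx1_repr (A B : 'M[residue m0]_d) l s : A *m B = 1%:M ->
  \sum_r repr (B r s) * repr (A l r) - (l == s)%:R \in mideal m0.
Proof.
move=> AB; apply/piresE; rewrite pires_sum.
under eq_bigr do rewrite piresM !reprK mulrC.
have := congr1 (fun M : 'M_d => M l s) AB; rewrite !mxE => ->.
by case: (l == s) => /=; [rewrite pires1|apply/esym/pires0; exact: rpred0].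
Qed.

Let mem_congr k (a b c : 'I_d -> R) e :
  (forall r, b r - c r \in mideal ('m_k)) ->
  \sum_r c r * a r - e \in mideal ('m_k) ->
  \sum_r b r * a r - e \in mideal ('m_k).
Proof.
move=> bc; set u := _ - e => um; set v := _ - e.
suff vu : v - u \in mideal ('m_k) by rewrite -[v](subrK u) rpredD.
rewrite /u /v opprB addrA subrK -sumrB; apply: rpred_sum => r _.
rewrite -mulrBl mulrC -[_ * _]addr0; have [_ _ mD] := (midealP ('m_k)).1.
by apply: mD; [exact: bc|exact: rpred0].
Qed.

Lemma repr_sigma_res (x : residue m0) :
  repr (sigma_res sigma x) - sigma (repr x) \in mideal ('m_1).
Proof. by apply/piresE; rewrite reprK. Qed.

Lemma cyc_HYX js : sY (Xe js) = t *: dbasis cyc_ideal js.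
Proof.
rewrite -cyc_eE /Xe; case: js => j s /=; have := ltn_ord j.
move: (val j) => k kp; rewrite /cyc_Xe.
have p0 : (0 < p)%N by exact: leq_ltn_trans kp.
case: eqP => [E|/eqP E]; last first.
  by rewrite sY_lin.2 rautK sY_e //= ltn_neqAle E.
rewrite sY_lin.2 rautK; congr (_ *: _).
rewrite (big_morph sY sY_lin.1 (semilin0 sY_lin)) E.
under eq_bigr => r _.
  rewrite sY_lin.2 (sY_e r (k := 1%N)) // /cyc_Ye eqxx.
over.
apply: collapse => l; rewrite sigmak_p.
apply: (mem_congr (k := 0%N)) (mx1_repr l s (mulVmx F_unit)) => r.
have := repr_sigma_res (F r s).
by rewrite mxE inE raut_invB rautK.
Qed.

Lemma cyc_HXY js : sX (Ye js) = sigma t *: dbasis cyc_ideal js.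
Proof.
rewrite -cyc_eE /Ye; case: js => j s /=; have := ltn_ord j.
move: (val j) => k kp; rewrite /cyc_Ye.
have p0 : (0 < p)%N by exact: leq_ltn_trans kp.
case: eqP => [[->]|/eqP E]; last first.
  have k0 : (0 < k)%N by rewrite lt0n -eqSS.
  by rewrite sX_e /= ?k0 ?(ltnW kp) // /cyc_Xe ltn_eqF.
rewrite (big_morph sX sX_lin.1 (semilin0 sX_lin)).
under eq_bigr => r _.
  rewrite sX_lin.2 (sX_e r (k := p)) ?p0 ?leqnn // /cyc_Xe eqxx.
  rewrite scalerA mulrC -scalerA.
over.
rewrite -scaler_sumr; congr (_ *: _).
apply: collapse => l.
have h : sigma (\sum_r repr (invmx F r s) * repr (F l r) - (l == s)%:R)
    \in mideal ('m_1).
  by rewrite inE rautK; apply: mx1_repr (mulmxV F_unit).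
under eq_bigr do rewrite mulrC.
rewrite rmorphB rmorph_nat rmorph_sum in h.
rewrite (eq_bigr (fun r => sigma (repr (F l r)) * sigma (repr (invmx F r s))))
  in h; last by move=> r _; rewrite rmorphM mulrC.
apply: mem_congr h => r.
by have := repr_sigma_res (F l r); rewrite mxE.
Qed.

Definition cyc_ops : gwa_ops sigma t :=
  basis_ops cyc_HX cyc_HY cyc_HYX cyc_HXY.

(* V^t(omega, 1^p, F); see [V_cyc_X] and [V_cyc_Y]. *)
Definition V_cyc : lmodType (gwa sigma t) := gwa_module cyc_ops.

Lemma V_cyc_X k s : (1 <= k <= p)%N ->
  gwaX sigma t *: (cyc_e k s : V_cyc) = cyc_Xe k s.
Proof. by move=> hk; rewrite (@gwaX_scale _ _ _ cyc_ops) -(sX_e s hk). Qed.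

Lemma V_cyc_Y k s : (1 <= k <= p)%N ->
  gwaY sigma t *: (cyc_e k s : V_cyc) = cyc_Ye k s.
Proof. by move=> hk; rewrite (@gwaY_scale _ _ _ cyc_ops) -(sY_e s hk). Qed.

End CyclicModule.

Definition lmod_iso (A : pzRingType) (M N : lmodType A) : Prop :=
  exists f : {linear M -> N}, bijective f.

(* Main.v *)
(* For k >= 1 the quotient N / m_k N of N = V^(t')(omega, 1^p, F) is k^d, and
   coordinates on it can be carried from m_k to m_(k+1) along the word w: since
   t' lies in no m_k, both X and Y are bijections there, and we use X when
   w_k = x and the inverse of Y otherwise. In these coordinates the matrix F
   disappears, because w is not cyclic: pairing the k-th component of
   V^t(omega, i, w) with the coordinates at m_k is an isomorphism onto
   V^(tt')(omega, i, w)^d. It is injective as e_k (x) m_k N = 0. Since m_k is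
   prime and t' is not in m_k, t and tt' have the same breaks. *)
From HB Require Import structures.
Require Import Defs.
From mathcomp Require Import all_boot all_algebra generic_quotient.
From mathcomp Require Import boolp classical_sets functions cardinality.

Set Implicit Arguments.
Unset Strict Implicit.
Unset Printing Implicit Defensive.

Import GRing.Theory.
Local Open Scope ring_scope.
Local Open Scope quotient_scope.

(** * Maximal ideals, their residue fields and the orbit *)

Section MaximalIdeals.
Variables (R : comNzRingType) (sigma : raut R).
Implicit Types m n : maxSpec R.

Lemma residue_pi_surj m (x : residue m) : exists r, x = \pi_(residue m) r.
Proof. by exists (repr x); rewrite reprK. Qed.

Lemma residueZE m r (x : residue m) : r *: x = \pi_(residue m) r * x.
Proof. by []. Qed.

Lemma mideal_inv_mod m r : r \notin mideal m -> exists a, a * r - 1 \in mideal m.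
Proof.
move=> rm; have : \pi_(residue m) r != 0.
  by apply/eqP => /pires0; rewrite (negbTE rm).
case/residue_inv_ex => y; have [a ->] := residue_pi_surj y.
by rewrite -piresM -pires1 => /piresE; exists a.
Qed.

Lemma mideal_mulr m r s : s \in mideal m -> r * s \in mideal m.
Proof. by move/pires0 => s0; apply/pires0; rewrite piresM s0 mulr0. Qed.

Lemma mideal_primeM m r s :
  (r * s \in mideal m) = (r \in mideal m) || (s \in mideal m).
Proof.
apply/idP/orP => [/pires0/eqP|[rm|sm]].
- by rewrite piresM mulf_eq0 => /orP[] /eqP/pires0 ?; [left|right].
- by rewrite mulrC mideal_mulr.
- exact: mideal_mulr.
Qed.

(** Maximality gives an element of m outside n; multiplying it by an inverse modulo n keeps it in
    m. *)
Lemma mideal_separate m n : m <> n ->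
  exists2 r, r \in mideal m & r - 1 \in mideal n.
Proof.
move=> mn; have [r rm rn] : exists2 r, r \in mideal m & r \notin mideal n.
  apply: contrapT => none; apply: mn; apply: maxSpec_eq => x.
  have sub : {subset mideal m <= mideal n}.
    by move=> r rm; apply/negPn/negP => rn; apply: none; exists r.
  by rewrite ((midealP m).2 _ (midealP n).1 sub).
have [a arn] := mideal_inv_mod rn.
by exists (a * r) => //; exact: mideal_mulr.
Qed.

Lemma sigma_max_inj : injective (sigma_max sigma).
Proof.
move=> m n mn; apply: maxSpec_eq => x.
have mE k : (sigma x \in mideal (sigma_max sigma k)) = (x \in mideal k).
  by rewrite inE rautK.
by rewrite -!mE mn.
Qed.

Section SigmaRes.
Variable m : maxSpec R.

Lemma sigma_res_pi r :
  sigma_res sigma (\pi_(residue m) r) = \pi_(residue (sigma_max sigma m)) (sigma r).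
Proof.
apply/piresE; rewrite -rmorphB inE rautK.
by apply/piresE; rewrite reprK.
Qed.

Lemma sigma_resD : {morph @sigma_res R sigma m : x y / x + y}.
Proof.
move=> x y; have [a ->] := residue_pi_surj x; have [b ->] := residue_pi_surj y.
by rewrite -piresD !sigma_res_pi rmorphD piresD.
Qed.

Lemma sigma_resM : {morph @sigma_res R sigma m : x y / x * y}.
Proof.
move=> x y; have [a ->] := residue_pi_surj x; have [b ->] := residue_pi_surj y.
by rewrite -piresM !sigma_res_pi rmorphM piresM.
Qed.

Lemma sigma_res_eq0 (x : residue m) : sigma_res sigma x = 0 -> x = 0.
Proof.
have [a ->] := residue_pi_surj x; rewrite sigma_res_pi => /pires0.
by rewrite inE rautK => /pires0.
Qed.

(** The inverse of [sigma_res] read off on representatives, in the form in which the semilinearity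
    of Y produces it. *)
Lemma sigma_res_reprV (x : residue m) :
  \pi_(residue m) (raut_inv sigma (repr (sigma_res sigma x))) = x.
Proof.
have [a ->] := residue_pi_surj x; rewrite sigma_res_pi.
apply/piresE; rewrite -{2}[a](rautK sigma) -raut_invB.
by have /piresE := reprK (\pi_(residue (sigma_max sigma m)) (sigma a)).
Qed.

Lemma sigma_res_surj (y : residue (sigma_max sigma m)) :
  exists x, sigma_res sigma x = y.
Proof.
have [a ->] := residue_pi_surj y; exists (\pi_(residue m) (raut_inv sigma a)).
by rewrite sigma_res_pi rautVK.
Qed.

Lemma sigma_resZ r (x : residue m) :
  sigma_res sigma (r *: x) = sigma r *: sigma_res sigma x.
Proof. by rewrite !residueZE sigma_resM sigma_res_pi. Qed.

End SigmaRes.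

Section Orbit.
Variables (m0 : maxSpec R) (p : nat).
Hypothesis sigma_p : forall r, iter p sigma r = r.
Local Notation "''m_' k" := (sigmak sigma m0 k) (at level 8, k at level 2).

Lemma sigmak_mod k : 'm_(k %% p)%N = 'm_k.
Proof.
rewrite [in RHS](divn_eq k p); elim: (k %/ p)%N => // q IH.
rewrite mulSn -addnA addnC /sigmak iterD -/(sigmak sigma m0 p).
by rewrite sigmak_p.
Qed.

(** A return to m_0 after k < p steps would make the orbit an image of [I_k], hence too small to
    have p elements. *)
Lemma sigmak_inj0 k : (orbit_set sigma m0 p #= `I_p)%card ->
  (0 < k < p)%N -> 'm_k <> m0.
Proof.
move=> /card_eqPle[_ card_p] /andP[k_gt0 k_p] kE.
have per j : 'm_(j %% k)%N = 'm_j.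
  rewrite [in RHS](divn_eq j k); elim: (j %/ k)%N => // q IH.
  by rewrite mulSn -addnA addnC /sigmak iterD -/(sigmak sigma m0 k) kE.
have sub : (orbit_set sigma m0 p `<=` (fun j => 'm_j) @` `I_k)%classic.
  by move=> _ [j _ ->]; exists (j %% k)%N; rewrite ?per //= ltn_mod.
have := card_le_trans card_p (card_le_trans (subset_card_le sub) (card_image_le _ _)).
by rewrite card_le_II leqNgt k_p.
Qed.

End Orbit.
End MaximalIdeals.

(** * Balanced biadditive maps and the tensor product *)

Section TensorLift.
Variables (R : comNzRingType) (M N : lmodType R) (W : zmodType) (B : M -> N -> W).
Hypothesis BDl : forall u u' v, B (u + u') v = B u v + B u' v.
Hypothesis BDr : forall u v v', B u (v + v') = B u v + B u v'.
Hypothesis BZ : forall r u v, B (r *: u) v = B u (r *: v).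

Definition tens_lift (z : tensor M N) : W :=
  \sum_(uv <- repr z) B uv.1 uv.2.

Lemma tens_lift_pi s :
  tens_lift (\pi_(tensor M N) s) = \sum_(uv <- s) B uv.1 uv.2.
Proof.
(* Needed for the rule [tc_0]; W, unlike lists, has cancellation. *)
have B0 v : B 0 v = 0 by apply: (addrI (B 0 v)); rewrite -BDl !addr0.
rewrite /tens_lift; move: (repr _) (repr_tcong s) => s'; elim=> //=.
- by move=> s1 s2 s3 _ -> _ ->.
- by move=> s1 s1' s2 s2' _ E1 _ E2; rewrite !big_cat /= E1 E2.
- by move=> s1 s2; rewrite !big_cat /= addrC.
- by move=> v; rewrite big_seq1 big_nil B0.
- by move=> u u' v; rewrite !big_cons !big_nil /= !addr0 BDl.
- by move=> u v v'; rewrite !big_cons !big_nil /= !addr0 BDr.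
- by move=> r u v; rewrite !big_seq1 BZ.
Qed.

Lemma tens_lift_tens u v : tens_lift (ttens u v) = B u v.
Proof. by rewrite tens_lift_pi big_seq1. Qed.

Lemma tens_liftD : {morph tens_lift : a b / a + b}.
Proof.
elim/quotW=> a; elim/quotW=> b.
rewrite -[\pi_(tensor M N) a + _]/(tens_add _ _) -pi_cat.
by rewrite !tens_lift_pi big_cat.
Qed.

End TensorLift.

Section TensorAdditive.
Variables (R : comNzRingType) (M N : lmodType R).

Lemma ttensDl (u u' : M) (v : N) : ttens (u + u') v = ttens u v + ttens u' v.
Proof.
transitivity (\pi_(tensor M N) ([:: (u, v)] ++ [:: (u', v)])); last exact: pi_cat.
by apply/tensorE; exact: tc_Dl.
Qed.

Lemma ttensDr (u : M) (v v' : N) : ttens u (v + v') = ttens u v + ttens u v'.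
Proof.
transitivity (\pi_(tensor M N) ([:: (u, v)] ++ [:: (u, v')])); last exact: pi_cat.
by apply/tensorE; exact: tc_Dr.
Qed.

Lemma ttens0l (v : N) : ttens (0 : M) v = 0.
Proof. by rewrite -(scale0r 0) ttens_Zl scale0r. Qed.

Lemma ttens0r (u : M) : ttens u (0 : N) = 0.
Proof. by rewrite -(scale0r 0) ttens_Zr scale0r. Qed.

Lemma ttens_suml (I : finType) (f : I -> M) (v : N) :
  ttens (\sum_i f i) v = \sum_i ttens (f i) v.
Proof.
apply: (big_morph (fun u => ttens u v)); last exact: ttens0l.
by move=> u u'; exact: ttensDl.
Qed.

End TensorAdditive.

(** * Homomorphisms and isomorphisms of modules *)

Lemma gwa_linear (R : comNzRingType) (sigma : raut R) (t : R)
    (M N : lmodType (gwa sigma t)) (f : M -> N) :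
  {morph f : u v / u + v} ->
  (forall r v, f (gwaC sigma t r *: v) = gwaC sigma t r *: f v) ->
  (forall v, f (gwaX sigma t *: v) = gwaX sigma t *: f v) ->
  (forall v, f (gwaY sigma t *: v) = gwaY sigma t *: f v) ->
  linear f.
Proof.
move=> fD fC fX fY a u v; rewrite fD; congr (_ + _).
(* An element of A(t) is the class of a formal expression, so compatibility spreads from the
   constants, X and Y by induction on expressions. *)
elim/quotW: a u.
have f0 : f 0 = 0 by apply: (addrI (f 0)); rewrite -fD !addr0.
elim=> [r|||a IHa b IHb|a IHa|a IHa b IHb] u; [exact: fC|exact: fX|exact: fY|..].
- by rewrite !pi_gaddE !scalerDl fD IHa IHb.
- rewrite (_ : \pi_(gwa sigma t) (GOpp a) = - \pi_(gwa sigma t) a); last exact: pi_gopp.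
  rewrite !scaleNr; apply: (addrI (f (\pi_(gwa sigma t) a *: u))).
  by rewrite -fD !subrr // IHa subrr.
- by rewrite !pi_gmulE -!scalerA IHa IHb.
Qed.

Lemma lmod_isoI (A : pzRingType) (M N : lmodType A) (f : M -> N) :
  linear f -> (forall u, f u = 0 -> u = 0) -> (forall v, exists u, f u = v) ->
  lmod_iso M N.
Proof.
move=> f_lin f_inj f_surj.
pose f' : {linear M -> N} := HB.pack f (GRing.isLinear.Build _ _ _ _ f f_lin).
have fB u v : f (u - v) = f u - f v by exact: (raddfB f').
exists f'; have [g gK] := choice f_surj; exists g => // u.
by apply/eqP; rewrite -subr_eq0; apply/eqP/f_inj; rewrite fB gK subrr.
Qed.

(** * The submodule m N and coordinates on N / m N *)

Inductive ideal_span (R : comNzRingType) (N : lmodType R) (I : {pred R}) :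
    N -> Prop :=
  | ideal_span0 : ideal_span I 0
  | ideal_spanD u v : ideal_span I u -> ideal_span I v -> ideal_span I (u + v)
  | ideal_spanZ r v : r \in I -> ideal_span I (r *: v).

(* The map c induces an isomorphism of N / m N with (R / m)^d. *)
Record coord_system (R : comNzRingType) (N : lmodType R) (m : maxSpec R)
    (d : nat) (c : N -> 'I_d -> residue m) : Prop := CoordSystem {
  coordD : forall u v s, c (u + v) s = c u s + c v s;
  coordZ : forall r v s, c (r *: v) s = r *: c v s;
  coord_surj : forall x : 'I_d -> residue m, exists v, forall s, c v s = x s;
  coord_ker : forall v, (forall s, c v s = 0) -> ideal_span (mideal m) v }.

Lemma ideal_spanZl (R : comNzRingType) (N : lmodType R) (m : maxSpec R) r (u : N) :
  ideal_span (mideal m) u -> ideal_span (mideal m) (r *: u).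
Proof.
elim=> [|u1 u2 _ IH1 _ IH2|r' u' r'm]; rewrite ?scaler0 ?scalerDr.
- exact: ideal_span0.
- exact: ideal_spanD.
- by rewrite scalerA; apply: ideal_spanZ; exact: mideal_mulr.
Qed.

Section CoordShift.
Variables (R : comNzRingType) (sigma : raut R) (t : R).
Variables (N : lmodType (gwa sigma t)) (d : nat) (m : maxSpec R).
Variable c : resR N -> 'I_d -> residue m.
Hypotheses (c_sys : coord_system c) (t_m : t \notin mideal m).
Variable lam : residue (sigma_max sigma m).
Hypothesis lam_neq0 : lam != 0.

(** Y carries sigma(m) N into m N, so coordinates at m can be pulled back along Y to sigma(m);
    [sigma_res] turns the result into an R-linear map. The unit [lam] leaves the freedom to
    normalise either X or Y. *)
Definition coord_shift (v : resR N) (s : 'I_d) : residue (sigma_max sigma m) :=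
  lam * sigma_res sigma (c (resY v) s).

Let st_m : sigma t \notin mideal (sigma_max sigma m).
Proof. by rewrite inE rautK. Qed.

Lemma coord_shift_X v s :
  coord_shift (resX v) s = lam * (sigma t *: sigma_res sigma (c v s)).
Proof. by rewrite /coord_shift resYX (coordZ c_sys) sigma_resZ. Qed.

Lemma coord_shift_system : coord_system coord_shift.
Proof.
split=> [u v s|r v s|x|v cv0].
- by rewrite /coord_shift resYD (coordD c_sys) sigma_resD mulrDr.
- rewrite /coord_shift resYZ (coordZ c_sys) sigma_resZ rautVK.
  by rewrite !residueZE mulrCA.
- have st0 : \pi_(residue (sigma_max sigma m)) (sigma t) != 0.
    by apply/eqP => /pires0; rewrite (negbTE st_m).
  (* A preimage of the form X v is sought. Since YX = t, the coordinates of X v carry the factor lam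
     sigma(t), which y divides out. *)
  have [y yE] := choice (fun s => sigma_res_surj
    ((lam * \pi_(residue (sigma_max sigma m)) (sigma t))^-1 * x s)).
  have [v vE] := coord_surj c_sys y; exists (resX v) => s.
  by rewrite coord_shift_X vE yE residueZE !mulrA mulfV ?mul1r // mulf_neq0.
have {cv0} : ideal_span (mideal m) (resY v).
  apply: (coord_ker c_sys) => s; apply: (@sigma_res_eq0 _ sigma).
  by have /eqP := cv0 s; rewrite mulf_eq0 (negbTE lam_neq0) => /eqP.
have [a aE] := mideal_inv_mod st_m.
have spanX u : ideal_span (mideal m) u ->
    ideal_span (mideal (sigma_max sigma m)) (resX u : resR N).
  elim=> [|u1 u2 _ IH1 _ IH2|r' u' r'm].
  - by rewrite /resX scaler0; exact: ideal_span0.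
  - by rewrite resXD; exact: ideal_spanD.
  - by rewrite resXZ; apply: ideal_spanZ; rewrite inE rautK.
(* Once Y v lies in m N, sigma(t) v = X Y v lies in sigma(m) N; then a, an inverse of sigma(t)
   modulo sigma(m), recovers v up to sigma(m) N. *)
move=> /spanX; rewrite resXY => /(@ideal_spanZl _ _ _ a _); rewrite scalerA => h.
have -> : v = (a * sigma t) *: v + (- 1) *: ((a * sigma t - 1) *: v).
  by rewrite scaleN1r scalerBl scale1r opprB addrC subrK.
by apply: ideal_spanD => //; apply: ideal_spanZl; exact: ideal_spanZ.
Qed.

End CoordShift.

(** Scalars from I move across the tensor sign, where they kill u. *)
Lemma ideal_span_ttens (R : comNzRingType) (M N : lmodType R) (I : {pred R})
    (u : M) (v : N) :
  (forall r, r \in I -> r *: u = 0) -> ideal_span I v -> ttens u v = 0.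
Proof.
move=> Iu; elim=> [|v1 v2 _ IH1 _ IH2|r v' rI]; first exact: ttens0r.
- by rewrite ttensDr IH1 IH2 addr0.
- by rewrite ttens_Zr -ttens_Zl Iu // ttens0l.
Qed.

(** * Tensoring a word module with a module that has coordinates at m_1 *)

Section WordTensor.
Variables (R : comNzRingType) (sigma : raut R) (p : nat) (m0 : maxSpec R).
Local Notation "''m_' k" := (sigmak sigma m0 k) (at level 8, k at level 2).
Variables (t t' : R) (i : nat) (w : seq letter).
Hypothesis t'_m : forall k, t' \notin mideal ('m_k).
Variable hw : word_ok sigma m0 p t i w.
Variable hw' : word_ok sigma m0 p (t * t') i w.
Variables (N : lmodType (gwa sigma t')) (d : nat).
Variable c1 : resR N -> 'I_d -> residue ('m_1).
Hypothesis c1_sys : coord_system c1.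

Local Notation space := (word_space sigma m0 i w).
Local Notation e k := (@word_e R sigma m0 i w k).

(* Passing from m_k to m_(k+1), the coordinates are chosen so that the basis
   vectors satisfy b_(k+1) = X b_k if w_k = x, and Y b_(k+1) = b_k otherwise. *)
Definition shift_factor n : residue ('m_(n.+2)) :=
  if letter_at i.+1 w n.+1 is Lx
  then (\pi_(residue ('m_(n.+2))) (sigma t'))^-1 else 1.

(* [coord n] holds the coordinates at m_(n+1), so that no index is truncated. *)
Fixpoint coord n : resR N -> 'I_d -> residue ('m_(n.+1)) :=
  if n is n'.+1 then coord_shift (coord n') (shift_factor n') else c1.

Let st' n : \pi_(residue ('m_(n.+1))) (sigma t') != 0.
Proof. by apply/eqP => /pires0; rewrite inE rautK (negbTE (t'_m n)). Qed.

Lemma coord_sys n : coord_system (coord n).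
Proof.
elim: n => [|n IH]; first exact: c1_sys.
apply: (coord_shift_system IH (t'_m n.+1) (lam := shift_factor n)).
by rewrite /shift_factor; case: letter_at; rewrite ?oner_eq0 ?invr_eq0 ?st'.
Qed.

Lemma coord_X_x n v s : letter_at i.+1 w n.+1 = Lx ->
  coord n.+1 (resX v) s = sigma_res sigma (coord n v s).
Proof.
move=> wn; rewrite /= (coord_shift_X (coord_sys n)) /shift_factor wn.
by rewrite residueZE mulrA mulVf ?mul1r ?st'.
Qed.

Lemma coord_X_1 n v s : letter_at i.+1 w n.+1 = L1 ->
  coord n.+1 (resX v) s = sigma t' *: sigma_res sigma (coord n v s).
Proof.
by move=> wn; rewrite /= (coord_shift_X (coord_sys n)) /shift_factor wn mul1r.
Qed.

Lemma coord_Y n v s : letter_at i.+1 w n.+1 <> Lx ->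
  coord n.+1 v s = sigma_res sigma (coord n (resY v) s).
Proof.
by rewrite /= /coord_shift /shift_factor; case: letter_at; rewrite ?mul1r.
Qed.

(** Position j carries e_(i+1+j), and [coord (i + j)] takes values in the same residue field because
    [i.+1 + j] reduces to [(i + j).+1]. *)
Definition word_pairing (u : resR (V_word hw)) (v : resR N) :
    {ffun 'I_d -> V_word hw'} :=
  [ffun s => (fun j => (u : space) j * coord (i + j) v s) : space].

Lemma V_wordC (t1 : R) (hw1 : word_ok sigma m0 p t1 i w) r (u : V_word hw1) :
  gwaC sigma t1 r *: u = (r *: (u : space)).
Proof. exact: gwaC_scale. Qed.

Lemma resV_wordZ r (u : resR (V_word hw)) : r *: u = (r *: (u : space)).
Proof. exact: V_wordC. Qed.

Lemma word_pairingDl u u' v :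
  word_pairing (u + u') v = word_pairing u v + word_pairing u' v.
Proof.
apply/ffunP => s; rewrite !ffunE; apply: dsumP => j.
exact: mulrDl.
Qed.

Lemma word_pairingDr u v v' :
  word_pairing u (v + v') = word_pairing u v + word_pairing u v'.
Proof.
apply/ffunP => s; rewrite !ffunE; apply: dsumP => j.
by rewrite dsumDE (coordD (coord_sys _)); exact: mulrDr.
Qed.

Lemma word_pairingZ r u v : word_pairing (r *: u) v = word_pairing u (r *: v).
Proof.
apply/ffunP => s; rewrite !ffunE; apply: dsumP => j.
rewrite (coordZ (coord_sys _)) resV_wordZ dsumZE !residueZE.
by rewrite mulrCA mulrA.
Qed.

Definition word_tensor_map : gwa_tensor (V_word hw) N -> {ffun 'I_d -> V_word hw'} :=
  tens_lift word_pairing.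

Let lift_tens u v : word_tensor_map (ttens u v) = word_pairing u v.
Proof. exact: tens_lift_tens word_pairingDl word_pairingDr word_pairingZ u v. Qed.

Let liftD : {morph word_tensor_map : a b / a + b}.
Proof. exact: tens_liftD word_pairingDl word_pairingDr word_pairingZ. Qed.

Lemma word_e_repr n (x : residue ('m_n)) r :
  x = \pi_(residue ('m_n)) r -> repr x *: e n = r *: e n.
Proof.
move=> xr; apply/eqP; rewrite -subr_eq0 -scalerBl word_e_ann //.
by apply/piresE; rewrite reprK.
Qed.

Lemma word_pairing_e n v s :
  word_pairing (e n.+1) v s = repr (coord n v s) *: e n.+1.
Proof.
rewrite ffunE; apply: dsumP => j; rewrite dsumZE /word_e addSn eqSS.
case: eqP => [<-|_]; last by rewrite mul0r scaler0.
by rewrite mul1r residueZE mulr1 reprK.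
Qed.

Lemma word_pairing0 v : word_pairing 0 v = 0.
Proof. by apply/ffunP => s; rewrite !ffunE; apply: dsumP => j; exact: mul0r. Qed.

Let V_wordXZ (t1 : R) (hw1 : word_ok sigma m0 p t1 i w) r (u : space) :
  gwaX sigma t1 *: ((r *: u : space) : V_word hw1) =
  (sigma r *: (gwaX sigma t1 *: (u : V_word hw1) : space)).
Proof. by rewrite -!V_wordC !scalerA gwaXC. Qed.

Let V_wordYZ (t1 : R) (hw1 : word_ok sigma m0 p t1 i w) r (u : space) :
  gwaY sigma t1 *: ((r *: u : space) : V_word hw1) =
  (raut_inv sigma r *: (gwaY sigma t1 *: (u : V_word hw1) : space)).
Proof. by rewrite -!V_wordC !scalerA gwaYC. Qed.

(** The coefficients of the left factor in the basis move across into the right factor, so basis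
    vectors suffice on the left. *)
Lemma word_tensor_ind (P : gwa_tensor (V_word hw) N -> Prop) :
  (forall j v, P (ttens (dbasis _ j : resR (V_word hw)) v)) ->
  (forall a b, P a -> P b -> P (a + b)) -> forall z, P z.
Proof.
move=> P1 PD; apply: tensor_ind => // u v.
have P0 : P 0.
  by rewrite -(ttens0r (resR N) (dbasis _ ord0 : resR (V_word hw))); exact: P1.
rewrite [u](dsum_basisE (u : space)).
rewrite ttens_suml; apply: (big_ind P) => // j _.
by rewrite -resV_wordZ ttens_Zl -ttens_Zr; exact: P1.
Qed.

Let position (j : 'I_(size w).+1) :
  exists n, (i.+1 <= n.+1 < i.+1 + (size w).+1)%N /\
    dbasis (word_ideal sigma m0 i (w := w)) j = e n.+1.
Proof.
by exists (i + j)%N; rewrite -word_eE -addSn leq_addr ltn_add2l ltn_ord.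
Qed.

Lemma word_tensor_mapX z :
  word_tensor_map (gwaX sigma (t * t') *: z) =
  gwaX sigma (t * t') *: word_tensor_map z.
Proof.
elim/word_tensor_ind: z => [j v|a b IHa IHb]; last first.
  by rewrite scalerDr !liftD IHa IHb scalerDr.
have [n [hn ->]] := position j.
have Xe : resX (e n.+1 : resR (V_word hw)) = @word_Xe R sigma m0 t i w n.+1.
  exact: V_word_X.
rewrite gwaX_scale [opX _]tensX_tens !lift_tens Xe.
apply/ffunP => s; rewrite [in RHS]ffunE [in RHS]word_pairing_e V_wordXZ V_word_X //.
rewrite /word_Xe; case: eqP => _; first by rewrite word_pairing0 ffunE scaler0.
case wn : letter_at.
(* Letter 1: sigma(t) from the word module and sigma(t') from the coordinate multiply to the
   sigma(tt') of the target. *)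
- rewrite -resV_wordZ word_pairingZ word_pairing_e (coordZ (coord_sys _)).
  rewrite coord_X_1 // !scalerA.
  apply: word_e_repr; rewrite !residueZE -{1}[coord n v s]reprK sigma_res_pi -!piresM.
  by rewrite (rmorphM sigma) mulrC.
(* Letter x: [shift_factor] has divided by sigma(t'), so no scalar appears, as in the target. *)
- rewrite word_pairing_e coord_X_x //; apply: word_e_repr.
  by rewrite -sigma_res_pi reprK.
- by rewrite word_pairing0 ffunE scaler0.
- by rewrite word_pairing0 ffunE scaler0.
Qed.

Lemma word_tensor_mapY z :
  word_tensor_map (gwaY sigma (t * t') *: z) =
  gwaY sigma (t * t') *: word_tensor_map z.
Proof.
elim/word_tensor_ind: z => [j v|a b IHa IHb]; last first.
  by rewrite scalerDr !liftD IHa IHb scalerDr.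
have [n [hn ->]] := position j.
have Ye : resY (e n.+1 : resR (V_word hw)) = @word_Ye R sigma m0 i w n.+1.
  exact: V_word_Y.
rewrite gwaY_scale [opY _]tensY_tens !lift_tens Ye.
apply/ffunP => s; rewrite [in RHS]ffunE [in RHS]word_pairing_e V_wordYZ V_word_Y //.
rewrite /word_Ye /=; case: eqP => [_|ni]; first by rewrite word_pairing0 ffunE scaler0.
(* The case n = 0 forces i = 0 and makes e_1 the first basis vector, which [ni] excludes; afterwards
   the vector is e_(n+2). *)
case: n hn Ye ni => [|n] hn Ye ni.
  by case: ni; case/andP: hn; rewrite ltnS leqn0 => /eqP ->.
(* This serves the letters 1 and y alike: in both, Y lowers the index of the basis vector with no
   scalar, and so does the transport of coordinates. *)
have back : letter_at i.+1 w n.+1 <> Lx ->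
    word_pairing (e n.+1) (resY v) s = raut_inv sigma (repr (coord n.+1 v s)) *: e n.+1.
  move=> wn; rewrite word_pairing_e; apply: word_e_repr.
  by rewrite coord_Y // sigma_res_reprV.
case wn : letter_at; first by apply: back; rewrite wn.
- by rewrite word_pairing0 ffunE scaler0.
- by apply: back; rewrite wn.
- by rewrite word_pairing0 ffunE scaler0.
Qed.

Lemma word_tensor_mapC r z :
  word_tensor_map (gwaC sigma (t * t') r *: z) =
  gwaC sigma (t * t') r *: word_tensor_map z.
Proof.
rewrite gwaC_scale; elim/word_tensor_ind: z => [j v|a b IHa IHb]; last first.
  by rewrite scalerDr !liftD IHa IHb scalerDr.
rewrite -ttens_Zl !lift_tens; apply/ffunP => s; rewrite !ffunE V_wordC.
apply: dsumP => l; rewrite dsumZE resV_wordZ dsumZE !residueZE.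
by rewrite mulrA.
Qed.

(** Position j sees only v_j. Hence the coordinates can be tested, and prescribed, independently at
    each position. *)
Lemma word_tensor_map_sum (v : 'I_(size w).+1 -> resR N) s (j : 'I_(size w).+1) :
  (word_tensor_map (\sum_l ttens (dbasis _ l : resR (V_word hw)) (v l)) s : space) j
  = coord (i + j) (v j) s.
Proof.
have lift0 : word_tensor_map 0 = 0.
  by apply: (addrI (word_tensor_map 0)); rewrite -liftD !addr0.
rewrite (big_morph _ liftD lift0) sum_ffunE.
rewrite [LHS]dsum_sumE (bigD1 j) //= big1 => [|l lj].
  by rewrite addr0 lift_tens ffunE /dbasis eqxx mul1r.
by rewrite lift_tens ffunE /dbasis eq_sym (negbTE lj) mul0r.
Qed.

Lemma word_tensor_map_inj z : word_tensor_map z = 0 -> z = 0.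
Proof.
(* Grouping by the left basis vector writes each tensor with one right factor per position, so that
   its image shows the coordinates of each factor. *)
have [v ->] : exists v : 'I_(size w).+1 -> resR N,
    z = \sum_j ttens (dbasis _ j : resR (V_word hw)) (v j).
  elim/word_tensor_ind: z => [j u|a b [va ->] [vb ->]].
    exists (fun l => if l == j then u else 0).
    rewrite (bigD1 j) //= eqxx big1 ?addr0 // => l /negbTE->.
    exact: ttens0r.
  exists (fun j => va j + vb j); rewrite -big_split; apply: eq_bigr => j _.
  by apply/esym; exact: ttensDr.
move=> sum0; apply: big1 => j _.
apply: ideal_span_ttens (coord_ker (coord_sys (i + j)) _).
  by move=> r rm; rewrite resV_wordZ; exact: dbasisZ0.
by move=> s; rewrite -word_tensor_map_sum sum0 ffunE.
Qed.

Lemma word_tensor_map_surj f : exists z, word_tensor_map z = f.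
Proof.
have [v vE] := choice (fun j : 'I_(size w).+1 =>
  coord_surj (coord_sys (i + j)) (fun s => (f s : space) j)).
exists (\sum_j ttens (dbasis _ j : resR (V_word hw)) (v j)).
by apply/ffunP => s; apply: dsumP => j; rewrite word_tensor_map_sum vE.
Qed.

Theorem V_word_tensor_iso :
  lmod_iso (gwa_tensor (V_word hw) N) {ffun 'I_d -> V_word hw'}.
Proof.
apply: lmod_isoI word_tensor_map_inj word_tensor_map_surj.
exact: gwa_linear liftD word_tensor_mapC word_tensor_mapX word_tensor_mapY.
Qed.

End WordTensor.

(** * Coordinates at m_1 on the cyclic module *)

Section CyclicCoord.
Variables (R : comNzRingType) (sigma : raut R) (m0 : maxSpec R) (p : nat).
Hypothesis sigma_p : forall r, iter p sigma r = r.
Hypothesis omega_p : (orbit_set sigma m0 p #= `I_p)%card.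
Variables (t : R) (d : nat) (F : 'M[residue m0]_d) (F_unit : F \in unitmx).
Hypothesis p_gt0 : (0 < p)%N.
Local Notation "''m_' k" := (sigmak sigma m0 k) (at level 8, k at level 2).
Local Notation space := (cyc_space sigma m0 p d).

(** The position with first entry 0 is that of the vectors e_(1,s). *)
Definition cyc_coord (v : resR (V_cyc sigma_p t F_unit)) (s : 'I_d) :
    residue ('m_1) := (v : space) (Ordinal p_gt0, s).

Lemma resV_cycZ r (u : resR (V_cyc sigma_p t F_unit)) : r *: u = (r *: (u : space)).
Proof. exact: gwaC_scale. Qed.

Lemma cyc_coord_system : coord_system cyc_coord.
Proof.
split=> [//|r v s|x|v v0]; first by rewrite /cyc_coord resV_cycZ.
  (* Only the entries at m_1 matter; reducing the same representatives elsewhere merely fills the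
     dependent function. *)
  pose u (js : 'I_p * 'I_d) : residue ('m_(js.1.+1)) :=
    \pi_(residue ('m_(js.1.+1))) (repr (x js.2)).
  by exists (u : space) => s; exact: reprK.
rewrite [v](dsum_basisE (v : space)).
apply: (big_ind (ideal_span (mideal ('m_1)))); first exact: ideal_span0.
  exact: ideal_spanD.
move=> [[[|j] jp] s] _.
  rewrite -resV_cycZ; apply: ideal_spanZ; apply/pires0; rewrite reprK.
  by have := v0 s; rewrite /cyc_coord (bool_irrelevance p_gt0 jp).
have jp' : (0 < j.+1 < p)%N by rewrite jp.
(* Cancelling one application of sigma reduces the claim to the fact that m_0 does not recur at
   index j + 1, which lies strictly between 0 and p. *)
have /mideal_separate[r rm rE] : 'm_1 <> 'm_(j.+2).
  by move=> /sigma_max_inj/esym; exact: sigmak_inj0 omega_p jp'.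
set b := dbasis _ _.
(* As r is 1 modulo the ideal annihilating b, it fixes b; as r is in m_1, this puts b in m_1 N. *)
have -> : b = r *: b.
  apply/eqP; rewrite eq_sym -subr_eq0 -{2}[b]scale1r -scalerBl.
  by rewrite [_ *: b](dbasisZ0 rE).
by rewrite -!resV_cycZ; apply: ideal_spanZl; exact: ideal_spanZ.
Qed.

End CyclicCoord.

Theorem lemma3p17 (R : comNzRingType) (sigma : raut R) (p : nat)
    (sigma_p : forall r : R, iter p sigma r = r)
    (m0 : maxSpec R)
    (omega_p : (orbit_set sigma m0 p #= `I_p)%card)
    (t t' : R) (t_reg : GRing.lreg t) (t'_reg : GRing.lreg t')
    (i : nat) (w : seq letter) (hw : word_ok sigma m0 p t i w)
    (Bt' : break_set sigma m0 p t' = set0)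
    (d : nat) (F : 'M[residue m0]_d) (F_unit : F \in unitmx) :
  exists hw' : word_ok sigma m0 p (t * t') i w,
    lmod_iso (gwa_tensor (V_word hw) (V_cyc sigma_p t' F_unit))
             {ffun 'I_d -> V_word hw'}.
Proof.
have [i_p break_l w_D break_r] := hw.
have p_gt0 : (0 < p)%N by exact: leq_ltn_trans i_p.
(* All k are covered, including k >= p, by reducing the index modulo p. *)
have t'_m k : t' \notin mideal (sigmak sigma m0 k).
  apply/negP => t'k; suff : break_set sigma m0 p t' (sigmak sigma m0 k) by rewrite Bt'.
  by split=> //; exists (k %% p)%N; rewrite ?ltn_mod ?sigmak_mod.
have breakE k : break_set sigma m0 p (t * t') (sigmak sigma m0 k)
    <-> break_set sigma m0 p t (sigmak sigma m0 k).
  by rewrite /break_set /= mideal_primeM (negbTE (t'_m k)) orbF.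
have hw' : word_ok sigma m0 p (t * t') i w.
  split=> //; [exact/breakE| |exact/breakE].
  by move=> k /w_D ->; rewrite breakE.
exists hw'; exact: (V_word_tensor_iso t'_m hw hw'
  (cyc_coord_system sigma_p omega_p t' F_unit p_gt0)).
Qed.
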